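(* Let $d<\infty$ and let $V,W\subset\mathbb{B}_d$ be analytic discs attached to the unit sphere with embedding maps $f$ and $g$ respectively. If $\mathcal{M}_f=\mathcal{M}_g$ (as sets of functions on $\mathbb{D}$), then for all $\xi,\zeta\in\mathbb{T}$, $$f(\xi)=f(\zeta)\iff g(\xi)=g(\zeta),$$ i.e. $f$ and $g$ have the same self-crossings on the boundary.
   Context: $\mathbb{D}$ is the open unit disc, $\mathbb{T}$ the unit circle, $\mathbb{B}_d$ the open Euclidean unit ball of $\mathbb{C}^d$. The Drury–Arveson space $H^2_d$ is the reproducing kernel Hilbert space on $\mathbb{B}_d$ with kernel $1/(1-\langle z,w\rangle)$, and $\mathcal{M}_d$ denotes its multiplier algebra. A variety is a subset of $\mathbb{B}_d$ which is the common zero set of some family of functions from $\mathcal{M}_d$. An analytic disc attached to the unit sphere is a variety $V\subset\mathbb{B}_d$ ($d<\infty$) for which there is an injective analytic map $f:\mathbb{D}\to\mathbb{B}_d$ with $f'(z)\neq0$ for all $z\in\mathbb{D}$, $V=f(\mathbb{D})$, $f$ extends to a $C^2$ map on $\overline{\mathbb{D}}$, and for $x\in\overline{\mathbb{D}}$, $\|f(x)\|=1$ iff $|x|=1$; such $f$ is called an embedding map of $V$. For such $f$, $\mathcal{H}_f$ is the reproducing kernel Hilbert space on $\mathbb{D}$ with kernel $k^f(z,w)=1/(1-\langle f(z),f(w)\rangle)$, and $\mathcal{M}_f$ is its multiplier algebra; equivalently $\mathcal{M}_f=\{\varphi\circ f:\varphi\in\mathcal{M}_d\}$ with the quotient norm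 $\|\psi\|=\inf\{\|\varphi\|_{\mathcal{M}_d}:\varphi\circ f=\psi\}$. *)

(* Defs.v *)
From Stdlib Require Import Reals.
From Coquelicot Require Import Coquelicot.
Open Scope R_scope.

Fixpoint csum (n : nat) (a : nat -> C) : C :=
  match n with
  | O => RtoC 0
  | S m => Cplus (csum m a) (a m)
  end.

(* Points of C^d are represented as [nat -> C] with coordinates >= d equal to 0. *)
Definition is_Cvec (d : nat) (z : nat -> C) : Prop :=
  forall i, (d <= i)%nat -> z i = RtoC 0.

Definition cinner (d : nat) (z w : nat -> C) : C :=
  csum d (fun i => Cmult (z i) (Cconj (w i))).

Definition vnorm (d : nat) (z : nat -> C) : R :=
  sqrt (Re (csum d (fun i => RtoC (Cmod (z i) ^ 2)))).

Definition in_ball (d : nat) (z : nat -> C) : Prop :=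
  is_Cvec d z /\ vnorm d z < 1.

Definition in_disc (x : C) : Prop := Cmod x < 1.

Definition Cnonneg (c : C) : Prop := Im c = 0 /\ 0 <= Re c.

Definition psd_kernel {X : Type} (dom : X -> Prop) (K : X -> X -> C) : Prop :=
  forall (n : nat) (x : nat -> X) (a : nat -> C),
    (forall i, (i < n)%nat -> dom (x i)) ->
    Cnonneg (csum n (fun i => csum n (fun j =>
       Cmult (Cmult (a i) (Cconj (a j))) (K (x i) (x j))))).

(* h belongs to the reproducing kernel Hilbert space H(K) on [dom]
   (Aronszajn: h in H(K) iff c^2 K(z,w) - h(z) conj(h(w)) is a positive
   kernel for some c, and then ||h|| <= c). *)
Definition rkhs_mem {X : Type} (dom : X -> Prop) (K : X -> X -> C)
    (h : X -> C) : Prop :=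
  exists c : R, psd_kernel dom
    (fun z w => Cminus (Cmult (RtoC (c ^ 2)) (K z w)) (Cmult (h z) (Cconj (h w)))).

Definition multiplier {X : Type} (dom : X -> Prop) (K : X -> X -> C)
    (phi : X -> C) : Prop :=
  forall h, rkhs_mem dom K h -> rkhs_mem dom K (fun z => Cmult (phi z) (h z)).

Definition DA_kernel (d : nat) (z w : nat -> C) : C :=
  Cinv (Cminus (RtoC 1) (cinner d z w)).

Definition in_Md (d : nat) (phi : (nat -> C) -> C) : Prop :=
  multiplier (in_ball d) (DA_kernel d) phi.

Definition is_variety (d : nat) (V : (nat -> C) -> Prop) : Prop :=
  exists S : ((nat -> C) -> C) -> Prop,
    (forall phi, S phi -> in_Md d phi) /\
    (forall z, V z <-> (in_ball d z /\ forall phi, S phi -> phi z = RtoC 0)).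

Definition C2_on_disc (r : R) (u : R -> R -> R) : Prop :=
  forall x y, Cmod (x, y) < r -> ex_diff_n u 2 x y.

(* f : D-bar -> C^d (given as a map on C whose values off the closed disc are
   irrelevant) is an embedding map of the analytic disc V attached to the sphere *)
Definition embedding_map (d : nat) (V : (nat -> C) -> Prop) (f : C -> nat -> C) : Prop :=
  is_variety d V /\
  (forall x, Cmod x <= 1 -> is_Cvec d (f x)) /\
  (forall x y, in_disc x -> in_disc y -> f x = f y -> x = y) /\
  (forall x, in_disc x ->
     (forall i, (i < d)%nat -> ex_derive (fun u : C => f u i) x) /\
     exists i, (i < d)%nat /\ exists l : C, is_derive (fun u : C => f u i) x l /\ l <> RtoC 0) /\
  (forall z, V z <-> exists x, in_disc x /\ f x = z) /\
  (* f extends to a C^2 map on the closed disc: it agrees there with a map which is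
     C^2 (as a map of two real variables) on a neighbourhood disc of radius r > 1 *)
  (exists (r : R) (F : C -> nat -> C), 1 < r /\
     (forall x, Cmod x <= 1 -> F x = f x) /\
     (forall i, (i < d)%nat ->
        C2_on_disc r (fun a b => Re (F (a, b) i)) /\
        C2_on_disc r (fun a b => Im (F (a, b) i)))) /\
  (forall x, Cmod x <= 1 -> (vnorm d (f x) = 1 <-> Cmod x = 1)).

Definition kf (d : nat) (f : C -> nat -> C) (z w : C) : C :=
  Cinv (Cminus (RtoC 1) (cinner d (f z) (f w))).

Definition in_Mf (d : nat) (f : C -> nat -> C) (psi : C -> C) : Prop :=
  multiplier in_disc (kf d f) psi.

(* Main.v *)
Require Import Defs.
From Stdlib Require Import Reals Lra Lia Classical ClassicalEpsilon FunctionalExtensionality.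
From Coquelicot Require Import Coquelicot.
Open Scope R_scope.
Set Bullet Behavior "Strict Subproofs".

(** Suppose [f xi = f zeta = p]. By the Hopf lemma applied to [Re <f, p> - 1], one has
    [<f (xi (1 - s)), p> = 1 - A s + O(s^2)] with [Re A > 0], and similarly at [zeta] with
    some [B]. Along [z_t = xi (1 - t/A)] and [w_t = zeta (1 - t/B)] the four kernel values
    [k(z_t, z_t), k(z_t, w_t), k(w_t, z_t), k(w_t, w_t)] are all [1/(2t) + O(1)], so
    [||k_{z_t} - k_{w_t}||] stays bounded, and hence so does [h z_t - h w_t] for every [h]
    in [H_f]. There is an [h] in [H_f] that is unbounded along [z_t]; comparing [h] with
    [psi h] forces [psi z_t - psi w_t -> 0] for each bounded multiplier [psi]. The coordinates
    of [g] belong to [M_g = M_f] and are continuous up to the boundary, so [g xi = g zeta]. *)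

(** The obstacle is that [k_{z_t}] and [k_{w_t}] each blow up, so their difference stays bounded
    only if the leading terms cancel exactly. This shapes two choices. Dividing [t] by [A] and by
    [B] makes both branches approach [p] at the same rate in [<., p>], whatever the two boundary
    derivatives are. The expansions must have error [O(t^2)], since inverting [2t + O(t^2)] then
    costs only [O(1)]; this is where C^2 regularity enters. Off the closed disc the C^2 extension is
    not holomorphic, so the Cauchy-Riemann equations are carried to the circle by continuity to get
    a complex linear first-order term there. No Hilbert space is built. Membership with norm at most
    [c] means positivity of [c^2 K - h conj(h)], so every norm estimate is a quadratic form
    evaluated at finitely many nodes. The unbounded [h] is an explicit weighted sum of normalised
    kernels; it is large along [z_t] because [1 / (1 - u)] has positive real part for [|u| < 1]. *)

(** * Finite complex sums and nonnegative complex numbers *)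

Lemma csum_ext (n : nat) (a b : nat -> C) :
  (forall i, (i < n)%nat -> a i = b i) -> csum n a = csum n b.
Proof.
  induction n as [|n IH]; intros H; simpl; [reflexivity|].
  rewrite IH, H; auto with arith.
Qed.

Lemma csum_plus (n : nat) (a b : nat -> C) :
  csum n (fun i => a i + b i)%C = (csum n a + csum n b)%C.
Proof. induction n as [|n IH]; simpl; [|rewrite IH]; ring. Qed.

Lemma csum_minus (n : nat) (a b : nat -> C) :
  csum n (fun i => a i - b i)%C = (csum n a - csum n b)%C.
Proof. induction n as [|n IH]; simpl; [|rewrite IH]; ring. Qed.

Lemma csum_mult_l (n : nat) (c : C) (a : nat -> C) :
  csum n (fun i => c * a i)%C = (c * csum n a)%C.
Proof. induction n as [|n IH]; simpl; [|rewrite IH]; ring. Qed.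

Lemma csum_mult_r (n : nat) (c : C) (a : nat -> C) :
  csum n (fun i => a i * c)%C = (csum n a * c)%C.
Proof. induction n as [|n IH]; simpl; [|rewrite IH]; ring. Qed.

Lemma csum_0 (n : nat) : csum n (fun _ => RtoC 0) = RtoC 0.
Proof. induction n as [|n IH]; simpl; [|rewrite IH]; ring. Qed.

Lemma csum_swap (n m : nat) (a : nat -> nat -> C) :
  csum n (fun i => csum m (fun j => a i j)) =
  csum m (fun j => csum n (fun i => a i j)).
Proof.
  induction n as [|n IH]; simpl; [now rewrite csum_0|].
  rewrite IH. symmetry. apply csum_plus.
Qed.

Lemma csum_conj (n : nat) (a : nat -> C) :
  Cconj (csum n a) = csum n (fun i => Cconj (a i)).
Proof.
  induction n as [|n IH]; simpl.
  - unfold Cconj; simpl. now rewrite Ropp_0.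
  - now rewrite Cplus_conj, IH.
Qed.

Lemma csum_mod_le (n : nat) (a : nat -> C) (M : R) :
  (forall i, (i < n)%nat -> Cmod (a i) <= M) -> Cmod (csum n a) <= INR n * M.
Proof.
  induction n as [|n IH]; intros H.
  - simpl. rewrite Cmod_0. lra.
  - rewrite S_INR. cbn [csum].
    pose proof (Cmod_triangle (csum n a) (a n)) as T.
    pose proof (H n ltac:(lia)) as Hn.
    assert (Cmod (csum n a) <= INR n * M) by (apply IH; auto with arith). lra.
Qed.

Lemma Cnonneg_plus (u v : C) : Cnonneg u -> Cnonneg v -> Cnonneg (u + v)%C.
Proof. destruct u, v; unfold Cnonneg; simpl; lra. Qed.

Lemma Cnonneg_sqr (u : C) : Cnonneg (u * Cconj u)%C.
Proof. destruct u as [x y]; unfold Cnonneg; simpl; split; [ring|nra]. Qed.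

Lemma RtoC_nonneg (u : C) : Cnonneg u -> u = RtoC (Re u).
Proof. destruct u as [x y]; intros [H _]; simpl in *; now subst. Qed.

Lemma Re_le_Cmod (z : C) : Re z <= Cmod z.
Proof. pose proof (re_le_Cmod z). pose proof (Rle_abs (Re z)). lra. Qed.

Lemma Rabs_Im_le_Cmod (z : C) : Rabs (Im z) <= Cmod z.
Proof.
  eapply Rle_trans; [|apply (Rmax_Cmod z)]. apply Rmax_r.
Qed.

Lemma Cmod_le_abs_sum (z : C) : Cmod z <= Rabs (Re z) + Rabs (Im z).
Proof.
  pose proof (Cmod_ge_0 z). pose proof (Cmod2_alt z).
  rewrite <- (pow2_abs (Re z)), <- (pow2_abs (Im z)) in H0.
  pose proof (Rabs_pos (Re z)). pose proof (Rabs_pos (Im z)). nra.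
Qed.

(** * Limits of complex sequences, reduced to real limits of moduli *)

Definition Ccv (u : nat -> C) (l : C) : Prop :=
  is_lim_seq (fun n => Cmod (u n - l)) 0.

Lemma Ccv_squeeze (u : nat -> C) (l : C) (e : nat -> R) :
  (forall n, Cmod (u n - l) <= e n) -> is_lim_seq e 0 -> Ccv u l.
Proof.
  intros H He. unfold Ccv.
  apply is_lim_seq_le_le with (fun _ => 0) e; auto using is_lim_seq_const.
  intros n; split; [apply Cmod_ge_0|apply H].
Qed.

Lemma Ccv_const (l : C) : Ccv (fun _ => l) l.
Proof.
  apply Ccv_squeeze with (fun _ => 0); [|apply is_lim_seq_const].
  intros _. replace (l - l)%C with (RtoC 0) by ring. rewrite Cmod_0. lra.
Qed.

Lemma Ccv_plus (u v : nat -> C) (l m : C) :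
  Ccv u l -> Ccv v m -> Ccv (fun n => u n + v n)%C (l + m)%C.
Proof.
  intros Hu Hv.
  apply Ccv_squeeze with (fun n => Cmod (u n - l) + Cmod (v n - m)).
  - intros n. replace (u n + v n - (l + m))%C with ((u n - l) + (v n - m))%C by ring.
    apply Cmod_triangle.
  - replace (Finite 0) with (Finite (0 + 0)) by (f_equal; ring).
    now apply (is_lim_seq_plus' _ _ 0 0).
Qed.

Lemma Ccv_mult (u v : nat -> C) (l m : C) :
  Ccv u l -> Ccv v m -> Ccv (fun n => u n * v n)%C (l * m)%C.
Proof.
  intros Hu Hv.
  apply Ccv_squeeze with (fun n => Cmod (u n - l) * Cmod (v n - m)
    + (Cmod l * Cmod (v n - m) + Cmod (u n - l) * Cmod m)).
  - intros n.
    replace (u n * v n - l * m)%C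
      with ((u n - l) * (v n - m) + (l * (v n - m) + (u n - l) * m))%C by ring.
    rewrite <- !Cmod_mult.
    eapply Rle_trans; [apply Cmod_triangle|].
    apply Rplus_le_compat_l, Cmod_triangle.
  - replace (Finite 0) with (Finite (0 * 0 + (Cmod l * 0 + 0 * Cmod m)))
      by (f_equal; ring).
    repeat first [apply is_lim_seq_plus' | apply is_lim_seq_mult'
                 | assumption | apply is_lim_seq_const].
Qed.

Lemma Ccv_conj (u : nat -> C) (l : C) :
  Ccv u l -> Ccv (fun n => Cconj (u n)) (Cconj l).
Proof.
  intros Hu. apply Ccv_squeeze with (fun n => Cmod (u n - l)); auto.
  intros n. rewrite <- Cminus_conj, Cmod_conj. lra.
Qed.

Lemma Ccv_csum (m : nat) (u : nat -> nat -> C) (l : nat -> C) :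
  (forall i, (i < m)%nat -> Ccv (fun n => u n i) (l i)) ->
  Ccv (fun n => csum m (u n)) (csum m l).
Proof.
  induction m as [|m IH]; intros H; simpl; [apply Ccv_const|].
  apply Ccv_plus; auto with arith.
Qed.

Lemma Ccv_Re (u : nat -> C) (l : C) : Ccv u l -> is_lim_seq (fun n => Re (u n)) (Re l).
Proof.
  intros H. apply is_lim_seq_le_le with
    (fun n => Re l - Cmod (u n - l)) (fun n => Re l + Cmod (u n - l)).
  - intros n. pose proof (re_le_Cmod (u n - l)) as Hn. simpl in Hn.
    apply Rabs_le_between in Hn. unfold Re. lra.
  - replace (Finite (Re l)) with (Finite (Re l - 0)) by (f_equal; ring).
    apply is_lim_seq_minus'; [apply is_lim_seq_const|exact H].
  - replace (Finite (Re l)) with (Finite (Re l + 0)) by (f_equal; ring).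
    apply is_lim_seq_plus'; [apply is_lim_seq_const|exact H].
Qed.

Lemma Cnonneg_lim (u : nat -> C) (l : C) :
  (forall n, Cnonneg (u n)) -> Ccv u l -> Cnonneg l.
Proof.
  intros H Hu. split.
  - assert (L : is_lim_seq (fun _ => Rabs (Im l)) 0).
    { apply is_lim_seq_le_le with (fun _ => 0) (fun n => Cmod (u n - l));
        auto using is_lim_seq_const.
      intros n; split; [apply Rabs_pos|].
      pose proof (Rabs_Im_le_Cmod (u n - l)) as Hn.
      destruct (H n) as [Hi _]. unfold Im in *. simpl in Hn. rewrite Hi in Hn.
      replace (0 + - snd l) with (- snd l) in Hn by ring.
      now rewrite Rabs_Ropp in Hn. }
    apply is_lim_seq_unique in L. rewrite Lim_seq_const in L.
    injection L as L. now apply Rabs_eq_0.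
  - apply (is_lim_seq_le (fun _ => 0) (fun n => Re (u n)) 0 (Re l)).
    + intros n; apply H.
    + apply is_lim_seq_const.
    + now apply Ccv_Re.
Qed.

(** * Positive kernels *)

Lemma psd_ext {X : Type} (dom : X -> Prop) (K L : X -> X -> C) :
  (forall z w, dom z -> dom w -> K z w = L z w) ->
  psd_kernel dom K -> psd_kernel dom L.
Proof.
  intros E H n x a Hx. specialize (H n x a Hx).
  erewrite csum_ext; [exact H|]. intros i Hi. apply csum_ext. intros j Hj.
  rewrite E; auto.
Qed.

Lemma psd_plus {X : Type} (dom : X -> Prop) (K L : X -> X -> C) :
  psd_kernel dom K -> psd_kernel dom L ->
  psd_kernel dom (fun z w => K z w + L z w)%C.
Proof.
  intros HK HL n x a Hx.
  pose proof (Cnonneg_plus _ _ (HK n x a Hx) (HL n x a Hx)) as H.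
  rewrite <- csum_plus in H. erewrite csum_ext; [exact H|].
  intros i Hi. cbv beta. rewrite <- csum_plus. apply csum_ext. intros; ring.
Qed.

(** The factor [phi] is absorbed into the coefficients, [a_i] becoming [a_i * phi (x_i)]. This
    rank-one case of the Schur product theorem suffices here, because [cinner] is a sum of [d] such
    factors. *)
Lemma psd_mult_rank_one {X : Type} (dom : X -> Prop) (K : X -> X -> C) (phi : X -> C) :
  psd_kernel dom K ->
  psd_kernel dom (fun z w => phi z * Cconj (phi w) * K z w)%C.
Proof.
  intros HK n x a Hx. pose proof (HK n x (fun i => a i * phi (x i))%C Hx) as H.
  erewrite csum_ext; [exact H|]. intros i Hi. apply csum_ext. intros j Hj. cbv beta.
  rewrite Cmult_conj. ring.
Qed.

Lemma psd_1 {X : Type} (dom : X -> Prop) : psd_kernel dom (fun _ _ => RtoC 1).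
Proof.
  intros n x a Hx.
  replace (csum n _) with (csum n a * Cconj (csum n a))%C; [apply Cnonneg_sqr|].
  rewrite csum_conj, <- csum_mult_r. apply csum_ext. intros i Hi.
  rewrite <- csum_mult_l. apply csum_ext. intros; ring.
Qed.

Lemma psd_0 {X : Type} (dom : X -> Prop) : psd_kernel dom (fun _ _ => RtoC 0).
Proof.
  apply psd_ext with (fun _ _ => RtoC 0 * Cconj (RtoC 0) * RtoC 1)%C.
  - intros; ring.
  - apply (psd_mult_rank_one dom (fun _ _ => RtoC 1) (fun _ => RtoC 0)), psd_1.
Qed.

Lemma psd_csum {X : Type} (dom : X -> Prop) (m : nat) (K : nat -> X -> X -> C) :
  (forall i, (i < m)%nat -> psd_kernel dom (K i)) ->
  psd_kernel dom (fun z w => csum m (fun i => K i z w)).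
Proof.
  induction m as [|m IH]; intros H; simpl; [apply psd_0|].
  apply (psd_plus dom (fun z w => csum m (fun i => K i z w)) (K m)); auto with arith.
Qed.

(** Each test of positivity is a finite sum, so pointwise convergence is enough. It serves both the
    geometric series for [kf] and the infinite sum defining the unbounded function. *)
Lemma psd_lim {X : Type} (dom : X -> Prop) (Kn : nat -> X -> X -> C) (K : X -> X -> C) :
  (forall n, psd_kernel dom (Kn n)) ->
  (forall z w, dom z -> dom w -> Ccv (fun n => Kn n z w) (K z w)) ->
  psd_kernel dom K.
Proof.
  intros HK Hcv m x a Hx.
  apply Cnonneg_lim with (fun n => csum m (fun i => csum m (fun j =>
    a i * Cconj (a j) * Kn n (x i) (x j))%C)).
  - intros n. now apply HK.
  - apply Ccv_csum. intros i Hi. apply Ccv_csum. intros j Hj.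
    apply Ccv_mult; [apply Ccv_const|auto].
Qed.

Definition hermitian {X : Type} (dom : X -> Prop) (K : X -> X -> C) : Prop :=
  forall z w, dom z -> dom w -> K z w = Cconj (K w z).

Lemma psd_diag {X : Type} (dom : X -> Prop) (K : X -> X -> C) (z : X) :
  psd_kernel dom K -> dom z -> Cnonneg (K z z).
Proof.
  intros HK Hz. pose proof (HK 1%nat (fun _ => z) (fun _ => RtoC 1) ltac:(auto)) as H.
  simpl in H.
  replace (K z z) with (RtoC 0 + (RtoC 0 + RtoC 1 * Cconj (RtoC 1) * K z z))%C; auto.
  replace (Cconj (RtoC 1)) with (RtoC 1); [ring|].
  unfold Cconj; simpl; now rewrite Ropp_0.
Qed.

(** Cauchy-Schwarz for the formal vectors [v = sum_i conj(a_i) k_{x_i}] and [k_z]: the double sum is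
    [||v||^2] and the single sum is their inner product. *)
Lemma psd_Cauchy_Schwarz {X : Type} (dom : X -> Prop) (K : X -> X -> C) n x a z :
  psd_kernel dom K -> hermitian dom K ->
  (forall i, (i < n)%nat -> dom (x i)) -> dom z ->
  Cmod (csum n (fun i => a i * K (x i) z)%C) ^ 2 <=
  Re (csum n (fun i => csum n (fun j => a i * Cconj (a j) * K (x i) (x j))%C))
    * Re (K z z).
Proof.
  intros HK Hh Hx Hz.
  set (T := csum n (fun i => a i * K (x i) z)%C).
  set (S := csum n (fun i => csum n (fun j => a i * Cconj (a j) * K (x i) (x j))%C)).
  (* Positivity at the [n + 1] nodes [x_0, ..., x_(n-1), z], with a free coefficient [lam] at the
     extra node; hermitian symmetry makes the two cross sums conjugate. *)
  assert (Q : forall lam : C,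
    Cnonneg (S + lam * Cconj T + Cconj lam * T + lam * Cconj lam * K z z)%C).
  { intros lam.
    set (x' := fun i => if Nat.ltb i n then x i else z).
    set (a' := fun i => if Nat.ltb i n then a i else lam).
    assert (Ex : forall i, (i < n)%nat -> x' i = x i /\ a' i = a i).
    { intros i Hi. unfold x', a'. apply Nat.ltb_lt in Hi. now rewrite Hi. }
    assert (En : x' n = z /\ a' n = lam).
    { unfold x', a'. now rewrite Nat.ltb_irrefl. }
    assert (Hx' : forall i, (i < Datatypes.S n)%nat -> dom (x' i)).
    { intros i _. unfold x'. destruct (Nat.ltb_spec i n); auto. }
    pose proof (HK (Datatypes.S n) x' a' Hx') as H. cbn [csum] in H.
    destruct En as [En1 En2]. rewrite En1, En2 in H.
    rewrite csum_plus in H.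
    rewrite (csum_ext n (fun i => csum n (fun j => a' i * Cconj (a' j) * K (x' i) (x' j))%C)
      (fun i => csum n (fun j => a i * Cconj (a j) * K (x i) (x j))%C)) in H.
    2:{ intros i Hi. apply csum_ext. intros j Hj.
        destruct (Ex i Hi) as [-> ->]. now destruct (Ex j Hj) as [-> ->]. }
    rewrite (csum_ext n (fun i => a' i * Cconj lam * K (x' i) z)%C
      (fun i => Cconj lam * (a i * K (x i) z))%C) in H.
    2:{ intros i Hi. destruct (Ex i Hi) as [-> ->]. ring. }
    rewrite (csum_ext n (fun j => lam * Cconj (a' j) * K z (x' j))%C
      (fun i => lam * Cconj (a i * K (x i) z))%C) in H.
    2:{ intros i Hi. destruct (Ex i Hi) as [-> ->].
        rewrite Cmult_conj, <- (Hh z (x i)); auto. ring. }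
    rewrite !csum_mult_l, <- csum_conj in H. fold T S in H.
    replace (S + lam * Cconj T + Cconj lam * T + lam * Cconj lam * K z z)%C
      with (S + Cconj lam * T + (lam * Cconj T + lam * Cconj lam * K z z))%C by ring.
    exact H. }
  rewrite (RtoC_nonneg _ (psd_diag dom K z HK Hz)) in Q.
  pose proof (psd_diag dom K z HK Hz) as [_ Hk].
  set (k := Re (K z z)) in *.
  assert (HS : 0 <= Re S) by (apply (HK n x a Hx)).
  rewrite Cmod2_alt.
  set (N := Re T ^ 2 + Im T ^ 2).
  (* Taking [lam = - tau T] aligns the phases and leaves a real quadratic in [tau], with
     [N = |T|^2]. *)
  assert (Q' : forall tau : R, 0 <= Re S - 2 * tau * N + tau ^ 2 * N * k).
  { intros tau. destruct (Q (RtoC (- tau) * T)%C) as [_ H].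
    replace (Re S - 2 * tau * N + tau ^ 2 * N * k) with
      (Re (S + RtoC (- tau) * T * Cconj T + Cconj (RtoC (- tau) * T) * T
           + RtoC (- tau) * T * Cconj (RtoC (- tau) * T) * RtoC k)%C).
    2:{ unfold N. clearbody S T k. destruct S, T. simpl. ring. }
    exact H. }
  assert (HN : 0 <= N) by (unfold N; nra).
  (* If [k = 0] the quadratic is affine in [tau] and would be negative at [S / N + 1] unless
     [N = 0]. Otherwise [tau = 1 / k] is its minimiser. *)
  destruct (Req_dec k 0) as [Hk0|Hk0].
  - rewrite Hk0. destruct (Req_dec N 0) as [->|HN0]; [lra|].
    pose proof (Q' (Re S / N + 1)) as H. rewrite Hk0 in H.
    replace (Re S - 2 * (Re S / N + 1) * N + (Re S / N + 1) ^ 2 * N * 0)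
      with (- Re S - 2 * N) in H by (field; auto). lra.
  - pose proof (Q' (/ k)) as H.
    replace (Re S - 2 * / k * N + (/ k) ^ 2 * N * k) with (Re S - N / k) in H by (field; auto).
    assert (0 < k) by lra.
    replace N with (N / k * k) by (field; auto).
    apply Rmult_le_compat_r; lra.
Qed.

Lemma psd_mod_le {X : Type} (dom : X -> Prop) (K : X -> X -> C) z w :
  psd_kernel dom K -> hermitian dom K -> dom z -> dom w ->
  Cmod (K z w) ^ 2 <= Re (K z z) * Re (K w w).
Proof.
  intros HK Hh Hz Hw.
  pose proof (psd_Cauchy_Schwarz dom K 1 (fun _ => z) (fun _ => RtoC 1) w HK Hh
    ltac:(auto) Hw) as H.
  simpl csum in H.
  assert (E : Cconj (RtoC 1) = RtoC 1) by (unfold Cconj; simpl; now rewrite Ropp_0).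
  rewrite E in H.
  replace (RtoC 0 + RtoC 1 * K z w)%C with (K z w) in H by ring.
  replace (RtoC 0 + (RtoC 0 + RtoC 1 * RtoC 1 * K z z))%C with (K z z) in H by ring.
  exact H.
Qed.

(** * Unbounded functions in a reproducing kernel space *)

(** Test the positive kernel at [z, w] with coefficients [1, -1]. The right-hand factor is
    [||k_z - k_w||^2], so a bound on it controls the oscillation of every member of the space. *)
Lemma rkhs_mem_diff {X : Type} (dom : X -> Prop) (K : X -> X -> C) (h : X -> C) :
  rkhs_mem dom K h ->
  exists c : R, forall z w, dom z -> dom w ->
    Cmod (h z - h w) ^ 2 <= c ^ 2 * Re (K z z + K w w - K z w - K w z)%C.
Proof.
  intros [c Hc]. exists c. intros z w Hz Hw.
  set (x := fun i : nat => match i with O => z | _ => w end).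
  set (a := fun i : nat => match i with O => RtoC 1 | _ => RtoC (-1) end).
  destruct (Hc 2%nat x a) as [_ H].
  { intros [|i] _; auto. }
  cbn [csum] in H. unfold x, a in H. simpl in H. rewrite Cmod2_alt. simpl.
  unfold Cconj in H; simpl in H. nra.
Qed.

Lemma sum_half_pow_le (N : nat) : sum_n (fun j => (/2) ^ j) N <= 2.
Proof.
  rewrite sum_n_Reals, tech3 by lra.
  assert (0 < (/2) ^ S N) by (apply pow_lt; lra).
  unfold Rdiv. replace (/ (1 - / 2)) with 2 by field. lra.
Qed.

(* Since [Re K >= 0], the terms of [sum_j 2^-j k_{z_j} / ||k_{z_j}||] cannot cancel. *)
Lemma rkhs_unbounded_mem {X : Type} (dom : X -> Prop) (K : X -> X -> C) (zs : nat -> X) :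
  psd_kernel dom K -> hermitian dom K ->
  (forall z w, dom z -> dom w -> 0 <= Re (K z w)) ->
  (forall j, dom (zs j)) ->
  (forall j, 16 ^ j <= Re (K (zs j) (zs j))) ->
  exists h, rkhs_mem dom K h /\ forall j, 2 ^ j <= Cmod (h (zs j)).
Proof.
  intros HK Hh Hre Hz Hbig.
  (* With this weight, [b j] times the kernel function at [zs j] has norm [2^-j]. *)
  set (b := fun j => (/2) ^ j * / sqrt (Re (K (zs j) (zs j)))).
  assert (Hk : forall j, 0 < Re (K (zs j) (zs j))).
  { intros j. eapply Rlt_le_trans; [|apply Hbig]. apply pow_lt; lra. }
  assert (Hb : forall j, 0 < b j).
  { intros j. apply Rmult_lt_0_compat; [apply pow_lt; lra|].
    apply Rinv_0_lt_compat, sqrt_lt_R0, Hk. }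
  (* Here [S] plays a squared norm and [T] the modulus of a pairing with the kernel at [zs j]. It is
     used with [S = K x x] for convergence at a point, and with the Gram form [Q] for the norm
     bound. *)
  assert (Hbs : forall j S T, 0 <= S -> T ^ 2 <= S * Re (K (zs j) (zs j)) -> 0 <= T ->
     b j * T <= sqrt S * (/2) ^ j).
  { intros j S T HS HT HT0.
    assert (H : T <= sqrt S * sqrt (Re (K (zs j) (zs j)))).
    { rewrite <- sqrt_mult by (auto; left; apply Hk).
      rewrite <- (sqrt_pow2 T) by auto. now apply sqrt_le_1_alt. }
    apply Rle_trans with (b j * (sqrt S * sqrt (Re (K (zs j) (zs j))))).
    - apply Rmult_le_compat_l; auto. left; apply Hb.
    - right. unfold b. field. apply Rgt_not_eq, sqrt_lt_R0, Hk. }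
  set (u := fun x j => (RtoC (b j) * K x (zs j))%C).
  assert (Hu : forall x j, dom x -> Cmod (u x j) <= sqrt (Re (K x x)) * (/2) ^ j).
  { intros x j Hx. unfold u. rewrite Cmod_mult, Cmod_R, Rabs_pos_eq by (left; apply Hb).
    apply Hbs; [apply (psd_diag dom K x HK Hx)|now apply (psd_mod_le dom)|apply Cmod_ge_0]. }
  assert (Hgeo : forall c : R, ex_series (fun j => c * (/2) ^ j)).
  { intros c. apply ex_series_scal_l with (a := fun j => (/2) ^ j).
    apply ex_series_geom. rewrite Rabs_pos_eq; lra. }
  assert (SRe : forall x, dom x -> ex_series (fun j => Re (u x j))).
  { intros x Hx. apply (@ex_series_le R_AbsRing R_CompleteNormedModule)
      with (fun j => sqrt (Re (K x x)) * (/2) ^ j); auto.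
    intros j. eapply Rle_trans; [apply re_le_Cmod|auto]. }
  assert (SIm : forall x, dom x -> ex_series (fun j => Im (u x j))).
  { intros x Hx. apply (@ex_series_le R_AbsRing R_CompleteNormedModule)
      with (fun j => sqrt (Re (K x x)) * (/2) ^ j); auto.
    intros j. eapply Rle_trans; [apply Rabs_Im_le_Cmod|auto]. }
  (* Off [dom] the series may diverge and take a default value, which positivity on [dom] never
     sees. *)
  set (h := fun x => (Series (fun j => Re (u x j)), Series (fun j => Im (u x j))) : C).
  set (hN := fun N x => csum N (u x)).
  (* [sum_n _ N] includes the index [N], hence [csum (S N)]. *)
  assert (Ere : forall x N, Re (csum (S N) (u x)) = sum_n (fun j => Re (u x j)) N).
  { intros x N. induction N as [|N IH].
    - rewrite sum_O. simpl. ring.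
    - rewrite sum_Sn, <- IH. reflexivity. }
  assert (Eim : forall x N, Im (csum (S N) (u x)) = sum_n (fun j => Im (u x j)) N).
  { intros x N. induction N as [|N IH].
    - rewrite sum_O. simpl. ring.
    - rewrite sum_Sn, <- IH. reflexivity. }
  assert (Hcv : forall x, dom x -> Ccv (fun N => hN (S N) x) (h x)).
  { intros x Hx. apply Ccv_squeeze with (fun N =>
      Rabs (sum_n (fun j => Re (u x j)) N - Series (fun j => Re (u x j)))
      + Rabs (sum_n (fun j => Im (u x j)) N - Series (fun j => Im (u x j)))).
    - intros N. eapply Rle_trans; [apply Cmod_le_abs_sum|].
      right. unfold hN. rewrite <- Ere, <- Eim. reflexivity.
    - replace (Finite 0) with (Finite (
        Rabs (Series (fun j => Re (u x j)) - Series (fun j => Re (u x j)))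
        + Rabs (Series (fun j => Im (u x j)) - Series (fun j => Im (u x j))))).
      2:{ f_equal. rewrite !Rminus_diag, Rabs_R0. ring. }
      apply is_lim_seq_plus';
        (eapply is_lim_seq_abs with (l := Finite _); apply is_lim_seq_minus'; [|apply is_lim_seq_const]).
      + exact (Series_correct _ (SRe x Hx)).
      + exact (Series_correct _ (SIm x Hx)). }
  exists h. split.
  (* The norm bound [2] is [sum_j 2^-j]. It holds for every partial sum and passes to the limit. *)
  - exists 2. apply psd_lim with (fun N z w =>
      RtoC (2 ^ 2) * K z w - hN (S N) z * Cconj (hN (S N) w))%C.
    + intros N n x a Hx.
      set (Q := csum n (fun i => csum n (fun j => a i * Cconj (a j) * K (x i) (x j))%C)).
      set (T := csum n (fun i => a i * hN (S N) (x i))%C).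
      assert (E : csum n (fun i => csum n (fun j => a i * Cconj (a j) *
        (RtoC (2 ^ 2) * K (x i) (x j) - hN (S N) (x i) * Cconj (hN (S N) (x j))))%C)
        = (RtoC (2 ^ 2) * Q - T * Cconj T)%C).
      { unfold Q, T. rewrite csum_conj, <- csum_mult_l, <- csum_mult_r, <- csum_minus.
        apply csum_ext. intros i Hi. rewrite <- !csum_mult_l, <- csum_minus.
        apply csum_ext. intros j Hj. rewrite Cmult_conj. ring. }
      rewrite E.
      assert (HQ : Cnonneg Q) by (apply HK; auto).
      rewrite (RtoC_nonneg _ HQ), <- Cmod2_conj, <- RtoC_mult, <- RtoC_minus.
      split; [reflexivity|]. simpl Re.
      destruct HQ as [_ HQ].
      (* Exchanging the two sums writes [T] as [sum_j b_j] times the pairing of the test vector with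
         the kernel at [zs j]; Cauchy-Schwarz bounds the [j]-th term by [2^-j sqrt (Re Q)]. *)
      assert (HT : Cmod T <= 2 * sqrt (Re Q)).
      { replace T with (csum (S N) (fun j => RtoC (b j) * csum n (fun i => a i * K (x i) (zs j)))%C).
        2:{ unfold T, hN, u.
            erewrite csum_ext; [|intros j Hj; rewrite <- csum_mult_l; reflexivity].
            rewrite csum_swap. apply csum_ext. intros i Hi.
            rewrite <- csum_mult_l. apply csum_ext. intros; ring. }
        apply Rle_trans with (sqrt (Re Q) * sum_n (fun j => (/2) ^ j) N).
        2:{ rewrite Rmult_comm. apply Rmult_le_compat_r; [apply sqrt_pos|apply sum_half_pow_le]. }
        assert (B : forall j, Cmod (RtoC (b j) * csum n (fun i => a i * K (x i) (zs j)))%C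
            <= sqrt (Re Q) * (/2) ^ j).
        { intros j. rewrite Cmod_mult, Cmod_R, Rabs_pos_eq by (left; apply Hb).
          apply Hbs; auto using Cmod_ge_0. now apply (psd_Cauchy_Schwarz dom). }
        clear -B. induction N as [|N IH].
        - rewrite sum_O. specialize (B O). cbn [csum]. now rewrite Cplus_0_l.
        - rewrite sum_Sn. cbn [csum]. cbn [csum] in IH. unfold plus; simpl plus.
          eapply Rle_trans; [apply Cmod_triangle|]. rewrite Rmult_plus_distr_l.
          apply Rplus_le_compat; auto. }
      pose proof (sqrt_sqrt _ HQ). pose proof (Cmod_ge_0 T). pose proof (sqrt_pos (Re Q)).
      nra.
    + intros z w Hzz Hww. unfold Cminus.
      apply Ccv_plus; [apply Ccv_const|].
      apply Ccv_squeeze with (fun N => Cmod ((hN (S N) z * Cconj (hN (S N) w)) - h z * Cconj (h w))).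
      * intros N. rewrite <- (Cmod_opp (hN (S N) z * _ - _)). right. f_equal. ring.
      * apply Ccv_mult; [|apply Ccv_conj]; auto.
  - intros j. eapply Rle_trans; [|apply Re_le_Cmod]. simpl Re.
    assert (Hpos : forall i, 0 <= Re (u (zs j) i)).
    { intros i. unfold u. rewrite re_scal_l. apply Rmult_le_pos; [left; auto|auto]. }
    (* All terms of the series have nonnegative real part, so the [j]-th alone is a lower bound. It
       equals [2^-j] times the norm of the kernel at [zs j], which is at least [4^j]: hence the
       threshold [16^j]. *)
    apply Rle_trans with (Re (u (zs j) j)).
    + unfold u. rewrite re_scal_l. unfold b.
      rewrite Rmult_assoc.
      replace (/ sqrt (Re (K (zs j) (zs j))) * Re (K (zs j) (zs j)))
        with (sqrt (Re (K (zs j) (zs j)))).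
      2:{ rewrite <- (sqrt_sqrt (Re (K (zs j) (zs j)))) at 3 by (left; auto).
          field. apply Rgt_not_eq, sqrt_lt_R0, Hk. }
      assert (4 ^ j <= sqrt (Re (K (zs j) (zs j)))).
      { rewrite <- (sqrt_pow2 (4 ^ j)) by (apply pow_le; lra). apply sqrt_le_1_alt.
        rewrite <- pow_mult, Nat.mul_comm, pow_mult. replace (4 ^ 2) with 16 by ring. auto. }
      replace (2 ^ j) with ((/2) ^ j * 4 ^ j) by (rewrite <- Rpow_mult_distr; f_equal; lra).
      apply Rmult_le_compat_l; auto. apply pow_le; lra.
    + specialize (SRe _ (Hz j)).
      set (v := fun i => Re (u (zs j) i)) in *.
      change (v j <= Series v). change (forall i, 0 <= v i) in Hpos.
      clearbody v. clear - Hpos SRe.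
      apply Rle_trans with (sum_n v j).
      * destruct j as [|j]; [rewrite sum_O; lra|]. rewrite sum_Sn.
        assert (0 <= sum_n v j).
        { rewrite sum_n_Reals. now apply cond_pos_sum. }
        unfold plus; simpl. lra.
      * rewrite sum_n_Reals. apply sum_incr.
        -- apply is_lim_seq_Reals. eapply is_lim_seq_ext; [|exact (Series_correct _ SRe)].
           intros n. apply sum_n_Reals.
        -- auto.
Qed.

(** Write [(psi z - psi w) h z = (psi z h z - psi w h w) - psi w (h z - h w)]. Both differences on
    the right are bounded, since [h] and [psi h] lie in the space and [||k_z - k_w||^2 <= D];
    dividing by [|h (zs j)| >= 2^j] gives the decay. *)
Lemma multiplier_asymptotic_collapse {X : Type} (dom : X -> Prop) (K : X -> X -> C)
    (zs ws : nat -> X) (psi : X -> C) (D : R) :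
  psd_kernel dom K -> hermitian dom K ->
  (forall z w, dom z -> dom w -> 0 <= Re (K z w)) ->
  (forall j, dom (zs j)) -> (forall j, dom (ws j)) ->
  (forall j, 16 ^ j <= Re (K (zs j) (zs j))) ->
  (forall j, Re (K (zs j) (zs j) + K (ws j) (ws j) - K (zs j) (ws j) - K (ws j) (zs j))%C <= D) ->
  multiplier dom K psi ->
  (forall j, Cmod (psi (ws j)) <= 1) ->
  exists B : R, forall j, Cmod (psi (zs j) - psi (ws j)) <= B * (/2) ^ j.
Proof.
  intros HK Hh Hre Hz Hw Hbig HD Hpsi Hb.
  destruct (rkhs_unbounded_mem dom K zs) as [h [Hmem Hh2]]; auto.
  destruct (rkhs_mem_diff _ _ _ Hmem) as [c Hc].
  destruct (rkhs_mem_diff _ _ _ (Hpsi h Hmem)) as [c' Hc'].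
  (* From [|e|^2 <= X] follows [|e| <= 1 + X], which avoids square roots; [Rmax D 0] avoids a sign
     discussion for [D]. *)
  assert (HB : forall (c : R) (e : nat -> C),
    (forall j, Cmod (e j) ^ 2 <= c ^ 2 *
       Re (K (zs j) (zs j) + K (ws j) (ws j) - K (zs j) (ws j) - K (ws j) (zs j))%C) ->
    forall j, Cmod (e j) <= 1 + c ^ 2 * Rmax D 0).
  { intros c0 e He j. specialize (He j). specialize (HD j).
    pose proof (Rmax_l D 0). pose proof (Rmax_r D 0).
    assert (Cmod (e j) ^ 2 <= c0 ^ 2 * Rmax D 0).
    { eapply Rle_trans; [exact He|]. apply Rmult_le_compat_l; [apply pow2_ge_0|lra]. }
    pose proof (Cmod_ge_0 (e j)). nra. }
  pose proof (HB c (fun j => h (zs j) - h (ws j))%C (fun j => Hc _ _ (Hz j) (Hw j))) as B1.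
  pose proof (HB c' (fun j => psi (zs j) * h (zs j) - psi (ws j) * h (ws j))%C
    (fun j => Hc' _ _ (Hz j) (Hw j))) as B2.
  set (b1 := 1 + c ^ 2 * Rmax D 0) in *. set (b2 := 1 + c' ^ 2 * Rmax D 0) in *.
  exists (b1 + b2). intros j. specialize (B1 j). specialize (B2 j). cbv beta in B1, B2.
  assert (E : Cmod ((psi (zs j) - psi (ws j)) * h (zs j)) <= b1 + b2).
  { replace ((psi (zs j) - psi (ws j)) * h (zs j))%C
      with ((psi (zs j) * h (zs j) - psi (ws j) * h (ws j))
            + - (psi (ws j) * (h (zs j) - h (ws j))))%C by ring.
    eapply Rle_trans; [apply Cmod_triangle|]. rewrite Cmod_opp, Cmod_mult.
    specialize (Hb j). pose proof (Cmod_ge_0 (h (zs j) - h (ws j))).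
    pose proof (Cmod_ge_0 (psi (ws j))). nra. }
  rewrite Cmod_mult in E.
  assert (P : 0 < 2 ^ j) by (apply pow_lt; lra).
  rewrite pow_inv. apply Rmult_le_reg_r with (2 ^ j); auto.
  rewrite Rmult_assoc, Rinv_l, Rmult_1_r by lra.
  eapply Rle_trans; [|exact E]. apply Rmult_le_compat_l; [apply Cmod_ge_0|auto].
Qed.

(** * The kernel of an embedded disc *)

(** The entry is masked by zero rather than removed, so the remainder is again a [csum] over the
    same indices and [psd_csum] applies to it. *)
Lemma csum_extract (n i : nat) (a : nat -> C) : (i < n)%nat ->
  csum n a = (a i + csum n (fun j => if Nat.eqb j i then RtoC 0 else a j))%C.
Proof.
  induction n as [|n IH]; intros Hi; [lia|]. cbn [csum].
  destruct (Nat.eqb_spec n i) as [->|Hn].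
  - rewrite (csum_ext i (fun j => if Nat.eqb j i then RtoC 0 else a j) a); [ring|].
    intros j Hj. destruct (Nat.eqb_spec j i); [lia|reflexivity].
  - rewrite IH by lia. ring.
Qed.

Lemma csum_nonneg (n : nat) (a : nat -> C) :
  (forall i, (i < n)%nat -> Cnonneg (a i)) -> Cnonneg (csum n a).
Proof.
  induction n as [|n IH]; intros H; cbn [csum].
  - split; simpl; lra.
  - apply Cnonneg_plus; auto with arith.
Qed.

Lemma cinner_self (d : nat) (z : nat -> C) : cinner d z z = RtoC (vnorm d z ^ 2).
Proof.
  unfold cinner, vnorm.
  rewrite (csum_ext d _ (fun i => RtoC (Cmod (z i) ^ 2))).
  2:{ intros i _. now rewrite Cmod2_conj. }
  assert (H : Cnonneg (csum d (fun i => RtoC (Cmod (z i) ^ 2)))).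
  { apply csum_nonneg. intros i _. split; [reflexivity|apply pow2_ge_0]. }
  rewrite pow2_sqrt by apply H. now apply RtoC_nonneg.
Qed.

Lemma cinner_conj (d : nat) (z w : nat -> C) : cinner d z w = Cconj (cinner d w z).
Proof.
  unfold cinner. rewrite csum_conj. apply csum_ext. intros i _.
  rewrite Cmult_conj, Cconj_conj. ring.
Qed.

Lemma vnorm_pos (d : nat) (z : nat -> C) : 0 <= vnorm d z.
Proof. apply sqrt_pos. Qed.

Lemma coord_le_vnorm (d i : nat) (z : nat -> C) : (i < d)%nat -> Cmod (z i) <= vnorm d z.
Proof.
  intros Hi.
  assert (H : Cmod (z i) ^ 2 <= vnorm d z ^ 2).
  { pose proof (cinner_self d z) as E. unfold cinner in E.
    rewrite (csum_extract d i) in E by auto. rewrite <- Cmod2_conj in E.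
    apply (f_equal Re) in E. rewrite re_plus, !re_RtoC in E. rewrite <- E.
    match goal with |- _ <= _ + Re ?s => assert (Hs : Cnonneg s) end.
    { apply csum_nonneg. intros j _. destruct (Nat.eqb j i).
      - split; simpl; lra.
      - apply Cnonneg_sqr. }
    destruct Hs as [_ Hs]. lra. }
  pose proof (vnorm_pos d z). pose proof (Cmod_ge_0 (z i)). nra.
Qed.

Lemma psd_mult_cinner {X : Type} (dom : X -> Prop) (K : X -> X -> C) d (f : X -> nat -> C) :
  psd_kernel dom K -> psd_kernel dom (fun z w => cinner d (f z) (f w) * K z w)%C.
Proof.
  intros HK.
  apply psd_ext with (fun z w => csum d (fun i => f z i * Cconj (f w i) * K z w)%C).
  - intros z w _ _. unfold cinner. now rewrite <- csum_mult_r.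
  - apply (psd_csum dom d (fun i z w => f z i * Cconj (f w i) * K z w)%C).
    intros i _. now apply (psd_mult_rank_one dom K (fun z => f z i)).
Qed.

(** The Euclidean inner product is itself a positive kernel on all vectors, so this is an instance
    of [psd_mod_le]. *)
Lemma cinner_mod_le (d : nat) (z w : nat -> C) :
  Cmod (cinner d z w) <= vnorm d z * vnorm d w.
Proof.
  assert (H : Cmod (cinner d z w) ^ 2 <= Re (cinner d z z) * Re (cinner d w w)).
  { apply (psd_mod_le (fun _ : nat -> C => True)); auto.
    - apply psd_ext with (fun z w => cinner d z w * RtoC 1)%C; [intros; ring|].
      apply (psd_mult_cinner _ (fun _ _ => RtoC 1) d (fun z => z)), psd_1.
    - intros x y _ _. apply cinner_conj. }
  rewrite !cinner_self, !re_RtoC, <- Rpow_mult_distr in H.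
  pose proof (Rmult_le_pos _ _ (vnorm_pos d z) (vnorm_pos d w)).
  pose proof (Cmod_ge_0 (cinner d z w)). nra.
Qed.

Section Ball_kernel.

Variables (d : nat) (f : C -> nat -> C).
Hypothesis f_ball : forall z, in_disc z -> vnorm d (f z) < 1.

Lemma cinner_lt_1 (z w : C) : in_disc z -> in_disc w -> Cmod (cinner d (f z) (f w)) < 1.
Proof.
  intros Hz Hw. eapply Rle_lt_trans; [apply cinner_mod_le|].
  pose proof (f_ball z Hz). pose proof (f_ball w Hw).
  pose proof (vnorm_pos d (f z)). pose proof (vnorm_pos d (f w)). nra.
Qed.

Lemma kf_denominator (z w : C) : in_disc z -> in_disc w ->
  0 < Re (1 - cinner d (f z) (f w))%C.
Proof.
  intros Hz Hw. pose proof (cinner_lt_1 z w Hz Hw) as H.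
  pose proof (Re_le_Cmod (cinner d (f z) (f w))).
  unfold Cminus. rewrite re_plus, re_opp, re_RtoC. lra.
Qed.

Lemma kf_denominator_neq_0 (z w : C) : in_disc z -> in_disc w ->
  (1 - cinner d (f z) (f w))%C <> 0.
Proof.
  intros Hz Hw E. pose proof (kf_denominator z w Hz Hw) as H.
  rewrite E in H. simpl in H. lra.
Qed.

(** The kernel is the geometric series in [A = <f z, f w>]. The partial sums [Kn] are in Horner
    form, so positivity propagates through multiplication by [A] and addition of [1]; they converge
    pointwise because [|A| < 1]. *)
Lemma kf_psd : psd_kernel in_disc (kf d f).
Proof.
  set (A := fun z w => cinner d (f z) (f w)).
  set (Kn := fix Kn (n : nat) (z w : C) : C :=
    match n with O => RtoC 0 | S n => (1 + A z w * Kn n z w)%C end).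
  assert (Hg : forall n z w, ((1 - A z w) * Kn n z w = 1 - A z w ^ n)%C).
  { intros n z w. induction n as [|n IH]; simpl; [ring|].
    replace ((1 - A z w) * (1 + A z w * Kn n z w))%C
      with ((1 - A z w) + A z w * ((1 - A z w) * Kn n z w))%C by ring.
    rewrite IH. ring. }
  apply psd_lim with Kn.
  - induction n as [|n IH].
    + apply psd_0.
    + apply (psd_plus in_disc (fun _ _ => RtoC 1) (fun z w => A z w * Kn n z w)%C).
      * apply psd_1.
      * now apply psd_mult_cinner.
  - intros z w Hz Hw.
    pose proof (kf_denominator_neq_0 z w Hz Hw) as Hne.
    pose proof (cinner_lt_1 z w Hz Hw) as Hlt. fold (A z w) in Hlt, Hne.
    apply Ccv_squeeze with (fun n => Cmod (/ (1 - A z w)) * Cmod (A z w) ^ n).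
    + intros n. right.
      replace (Kn n z w) with (/ (1 - A z w) * ((1 - A z w) * Kn n z w))%C
        by (field; auto).
      rewrite Hg. unfold kf. fold (A z w).
      replace (/ (1 - A z w) * (1 - A z w ^ n) - / (1 - A z w))%C
        with (- (/ (1 - A z w) * A z w ^ n))%C by ring.
      now rewrite Cmod_opp, Cmod_mult, Cmod_pow.
    + replace (Finite 0) with (Finite (Cmod (/ (1 - A z w)) * 0)) by (f_equal; ring).
      apply is_lim_seq_mult'; [apply is_lim_seq_const|].
      apply is_lim_seq_geom. rewrite Rabs_pos_eq; auto. apply Cmod_ge_0.
Qed.

Lemma kf_hermitian : hermitian in_disc (kf d f).
Proof.
  intros z w Hz Hw. unfold kf.
  rewrite Cinv_conj by now apply kf_denominator_neq_0.
  rewrite Cminus_conj, <- cinner_conj.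
  f_equal. f_equal. unfold Cconj; simpl; now rewrite Ropp_0.
Qed.

Lemma kf_Re_pos (z w : C) : in_disc z -> in_disc w -> 0 <= Re (kf d f z w).
Proof.
  intros Hz Hw. pose proof (kf_denominator z w Hz Hw) as H. unfold kf.
  set (u := (1 - cinner d (f z) (f w))%C) in *. clearbody u.
  destruct u as [x y]. simpl in *. left. apply Rdiv_lt_0_compat; nra.
Qed.

(** Multiplication by a coordinate is a contraction, so the same [c] works:
    [c^2 k - f_i conj(f_i) h conj(h)] is [f_i conj(f_i) (c^2 k - h conj(h))] plus
    [c^2 (1 - f_i conj(f_i)) k], and both summands are positive. *)
Lemma coord_in_Mf (i : nat) : (i < d)%nat -> in_Mf d f (fun z => f z i).
Proof.
  intros Hi h [c Hc]. exists c.
  (* [(1 - f_i f_i^* ) k = 1 + sum_(j <> i) f_j f_j^* k] because [(1 - <f, f>) k = 1]. *)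
  set (rest := fun z w => csum d (fun j =>
    if Nat.eqb j i then RtoC 0 else (f z j * Cconj (f w j) * kf d f z w)%C)).
  apply psd_ext with (fun z w =>
    f z i * Cconj (f w i) * (RtoC (c ^ 2) * kf d f z w - h z * Cconj (h w))
    + RtoC c * Cconj (RtoC c) * (1 + rest z w))%C.
  - intros z w Hz Hw. pose proof (kf_denominator_neq_0 z w Hz Hw) as Hne.
    assert (E : ((1 - cinner d (f z) (f w)) * kf d f z w = 1)%C) by now apply Cinv_r.
    unfold cinner in E. rewrite (csum_extract d i) in E by auto.
    replace (rest z w) with (csum d (fun j =>
      if Nat.eqb j i then RtoC 0 else (f z j * Cconj (f w j))%C) * kf d f z w)%C.
    2:{ unfold rest. rewrite <- csum_mult_r. apply csum_ext. intros j _.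
        destruct (Nat.eqb j i); ring. }
    rewrite <- E. rewrite !Cmult_conj.
    replace (Cconj (RtoC c)) with (RtoC c) by (unfold Cconj; simpl; now rewrite Ropp_0).
    replace (RtoC (c ^ 2)) with (RtoC c * RtoC c)%C by (rewrite <- RtoC_mult; f_equal; ring).
    ring.
  - apply psd_plus.
    + now apply (psd_mult_rank_one in_disc _ (fun z => f z i)).
    + apply (psd_mult_rank_one in_disc _ (fun _ => RtoC c)).
      apply psd_plus; [apply psd_1|].
      apply (psd_csum in_disc d (fun j z w =>
        if Nat.eqb j i then RtoC 0 else (f z j * Cconj (f w j) * kf d f z w)%C)).
      intros j _. destruct (Nat.eqb j i); [apply psd_0|].
      apply (psd_mult_rank_one in_disc _ (fun z => f z j)), kf_psd.
Qed.

End Ball_kernel.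

(** * The Hopf boundary lemma for harmonic functions *)

(** Compactness of the square in gauge form: the local radii [e] are chosen as a gauge,
    [compactness_value_2d] bounds the relevant ones below by one [d], and monotonicity in [e]
    transfers [P] to that [d]. *)
Lemma square_compactness (K : R -> R -> Prop) (P : R -> R -> R -> Prop) :
  (forall x y, K x y -> -1 <= x <= 1 /\ -1 <= y <= 1) ->
  (forall d e x y, 0 < d <= e -> P e x y -> P d x y) ->
  (forall u v, exists e : posreal, forall x y, K x y ->
     Rabs (x - u) < e -> Rabs (y - v) < e -> P e x y) ->
  exists d : posreal, forall x y, K x y -> P d x y.
Proof.
  intros HK Hmon Hloc.
  pose (delta := fun u v => proj1_sig (constructive_indefinite_description _ (Hloc u v))).
  assert (Hdelta : forall u v x y, K x y ->
     Rabs (x - u) < delta u v -> Rabs (y - v) < delta u v -> P (delta u v) x y).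
  { intros u v. exact (proj2_sig (constructive_indefinite_description _ (Hloc u v))). }
  destruct (compactness_value_2d (-1) 1 (-1) 1 delta) as [d Hd].
  exists d. intros x y Hxy. destruct (HK x y Hxy) as [Hx Hy].
  apply NNPP. intros N. apply (Hd x y Hx Hy). intros (u & v & _ & _ & H1 & H2 & H3).
  apply N. apply Hmon with (delta u v); auto. split; auto. apply cond_pos.
Qed.

Lemma square_max (K : R -> R -> Prop) (w : R -> R -> R) (x0 y0 : R) :
  (forall x y, K x y -> -1 <= x <= 1 /\ -1 <= y <= 1) ->
  (forall u v, ~ K u v -> locally_2d (fun x y => ~ K x y) u v) ->
  (forall x y, K x y -> continuity_2d_pt w x y) ->
  K x0 y0 ->
  exists x1 y1, K x1 y1 /\ forall x y, K x y -> w x y <= w x1 y1.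
Proof.
  intros HK Hcl Hc H0.
  (* First use: boundedness of [w], with [/ d] as the bound. Near points off [K] the local condition
     is vacuous by closedness. *)
  destruct (square_compactness K (fun d x y => w x y <= / d)) as [d Hd]; auto.
  { intros d e x y Hde H. eapply Rle_trans; [exact H|]. apply Rinv_le_contravar; lra. }
  { intros u v. destruct (classic (K u v)) as [Huv|Huv].
    - destruct (Hc u v Huv (mkposreal 1 Rlt_0_1)) as [e He]. simpl in He.
      assert (Hp : 0 < / (Rabs (w u v) + 1)).
      { apply Rinv_0_lt_compat. pose proof (Rabs_pos (w u v)). lra. }
      exists (mkposreal _ (Rmin_stable_in_posreal e (mkposreal _ Hp))). simpl.
      intros x y _ Hx Hy.
      pose proof (Rmin_l e (/ (Rabs (w u v) + 1))) as M1.
      pose proof (Rmin_r e (/ (Rabs (w u v) + 1))) as M2.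
      specialize (He x y ltac:(lra) ltac:(lra)).
      apply Rle_trans with (Rabs (w u v) + 1).
      + apply Rabs_lt_between in He. pose proof (Rle_abs (w u v)). lra.
      + apply Rle_trans with (/ / (Rabs (w u v) + 1)); [right; now rewrite Rinv_inv|].
        apply Rinv_le_contravar; auto. apply Rmin_glb_lt; auto. apply cond_pos.
    - destruct (Hcl u v Huv) as [e He]. exists e. intros x y Hxy Hx Hy.
      now destruct (He x y Hx Hy). }
  destruct (completeness (fun r => exists x y, K x y /\ r = w x y)) as [M [HM1 HM2]].
  { exists (/ d). intros r (x & y & Hxy & ->). auto. }
  { now exists (w x0 y0), x0, y0. }
  apply NNPP. intros N.
  assert (Hlt : forall x y, K x y -> w x y < M).
  { intros x y Hxy. destruct (HM1 (w x y)) as [H|H]; eauto.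
    exfalso. apply N. exists x, y. split; auto. intros x' y' H'. rewrite H. apply HM1. eauto. }
  (* Second use: if the supremum [M] were not attained, [w] would stay below [M] by a uniform
     gap. *)
  destruct (square_compactness K (fun d x y => w x y <= M - d)) as [m Hm]; auto.
  { intros a b x y Hab H. lra. }
  { intros u v. destruct (classic (K u v)) as [Huv|Huv].
    - assert (Hp : 0 < (M - w u v) / 2) by (pose proof (Hlt u v Huv); lra).
      destruct (Hc u v Huv (mkposreal _ Hp)) as [e He]. simpl in He.
      exists (mkposreal _ (Rmin_stable_in_posreal e (mkposreal _ Hp))). simpl.
      intros x y _ Hx Hy.
      pose proof (Rmin_l e ((M - w u v) / 2)) as M1.
      pose proof (Rmin_r e ((M - w u v) / 2)) as M2.
      specialize (He x y ltac:(lra) ltac:(lra)). apply Rabs_lt_between in He. lra.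
    - destruct (Hcl u v Huv) as [e He]. exists e. intros x y Hxy Hx Hy.
      now destruct (He x y Hx Hy). }
  assert (M <= M - m).
  { apply HM2. intros r (x & y & Hxy & ->). auto. }
  pose proof (cond_pos m). lra.
Qed.

Lemma is_derive_expansion (g : R -> R) (x l : R) : is_derive g x l ->
  forall e : posreal, exists d : posreal, forall y, Rabs (y - x) < d ->
    Rabs (g y - g x - l * (y - x)) <= e * Rabs (y - x).
Proof.
  intros H e. apply is_derive_Reals in H. destruct (H e (cond_pos e)) as [d Hd].
  exists d. intros y Hy. destruct (Req_dec y x) as [->|Hne].
  - replace (g x - g x - l * (x - x)) with 0 by ring. rewrite Rminus_diag, Rabs_R0. lra.
  - specialize (Hd (y - x) ltac:(lra) Hy). replace (x + (y - x)) with y in Hd by ring.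
    replace (g y - g x - l * (y - x)) with (((g y - g x) / (y - x) - l) * (y - x))
      by (field; lra).
    rewrite Rabs_mult. apply Rmult_le_compat_r; [apply Rabs_pos|lra].
Qed.

(** If [l > 0], then [g'] lies above [g' x] just right of [x] and below it just left. When
    [g' x >= 0] the function exceeds [g x] on the right, and when [g' x < 0] on the left. The split
    on the sign replaces a proof that [g' x = 0]. *)
Lemma second_derivative_at_max (g g' : R -> R) (x l : R) (r : posreal) :
  (forall y, Rabs (y - x) < r -> is_derive g y (g' y)) ->
  is_derive g' x l ->
  (forall y, Rabs (y - x) < r -> g y <= g x) ->
  l <= 0.
Proof.
  intros Hg Hg' Hmax. apply Rnot_lt_le. intros Hl.
  assert (Hl2 : 0 < l / 2) by lra.
  destruct (is_derive_expansion g' x l Hg' (mkposreal _ Hl2)) as [d Hd]. simpl in Hd.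
  pose proof (cond_pos r) as Hr. pose proof (cond_pos d) as Hd0.
  set (t := Rmin r d / 2).
  assert (Ht : 0 < t /\ t < r /\ t < d).
  { pose proof (Rmin_l r d). pose proof (Rmin_r r d).
    assert (0 < Rmin r d) by (apply Rmin_glb_lt; auto). unfold t; lra. }
  destruct (Rle_dec 0 (g' x)) as [Hs|Hs].
  - destruct (MVT_cor2 g g' x (x + t)) as [c [E Hc]]; [lra| |].
    + intros y Hy. apply is_derive_Reals, Hg. rewrite Rabs_pos_eq; lra.
    + assert (Hm : g (x + t) <= g x) by (apply Hmax; rewrite Rabs_pos_eq; lra).
      assert (Hc' : Rabs (c - x) < d) by (rewrite Rabs_pos_eq; lra).
      specialize (Hd c Hc'). rewrite (Rabs_pos_eq (c - x)) in Hd by lra.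
      apply Rabs_le_between in Hd. replace (x + t - x) with t in E by ring.
      assert (0 < l / 2 * (c - x)) by (apply Rmult_lt_0_compat; lra).
      assert (0 < g' c * t) by (apply Rmult_lt_0_compat; lra). lra.
  - destruct (MVT_cor2 g g' (x - t) x) as [c [E Hc]]; [lra| |].
    + intros y Hy. apply is_derive_Reals, Hg. rewrite Rabs_left1; lra.
    + assert (Hm : g (x - t) <= g x) by (apply Hmax; rewrite Rabs_left1; lra).
      assert (Hc' : Rabs (c - x) < d) by (rewrite Rabs_left1; lra).
      specialize (Hd c Hc'). rewrite (Rabs_left1 (c - x)) in Hd by lra.
      apply Rabs_le_between in Hd. replace (x - (x - t)) with t in E by ring.
      assert (0 < l / 2 * (x - c)) by (apply Rmult_lt_0_compat; lra).
      assert (0 < - g' c * t) by (apply Rmult_lt_0_compat; lra). lra.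
Qed.

(** The partial derivatives are carried as witness functions, so that linear combinations of
    harmonic functions simply combine the witnesses. *)
Definition harmonic_on (D : R -> R -> Prop) (v : R -> R -> R) : Prop :=
  exists v1 v2 v11 v22 : R -> R -> R, forall x y, D x y ->
    is_derive (fun t => v t y) x (v1 x y) /\
    is_derive (fun t => v1 t y) x (v11 x y) /\
    is_derive (fun t => v x t) y (v2 x y) /\
    is_derive (fun t => v2 x t) y (v22 x y) /\
    v11 x y + v22 x y = 0.

Lemma harmonic_const (D : R -> R -> Prop) (c : R) : harmonic_on D (fun _ _ => c).
Proof.
  exists (fun _ _ => 0), (fun _ _ => 0), (fun _ _ => 0), (fun _ _ => 0). intros x y _.
  refine (conj _ (conj _ (conj _ (conj _ _)))); try apply @is_derive_const. ring.
Qed.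

Lemma harmonic_plus (D : R -> R -> Prop) (u v : R -> R -> R) :
  harmonic_on D u -> harmonic_on D v -> harmonic_on D (fun x y => u x y + v x y).
Proof.
  intros (u1 & u2 & u11 & u22 & Hu) (v1 & v2 & v11 & v22 & Hv).
  exists (fun x y => u1 x y + v1 x y), (fun x y => u2 x y + v2 x y),
    (fun x y => u11 x y + v11 x y), (fun x y => u22 x y + v22 x y).
  intros x y Hxy. destruct (Hu x y Hxy) as (A1 & A2 & A3 & A4 & A5).
  destruct (Hv x y Hxy) as (B1 & B2 & B3 & B4 & B5).
  refine (conj _ (conj _ (conj _ (conj _ _))));
    [ now apply (is_derive_plus (fun t => u t y) (fun t => v t y))
    | now apply (is_derive_plus (fun t => u1 t y) (fun t => v1 t y))
    | now apply (is_derive_plus (fun t => u x t) (fun t => v x t))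
    | now apply (is_derive_plus (fun t => u2 x t) (fun t => v2 x t)) | lra].
Qed.

Lemma harmonic_scal (D : R -> R -> Prop) (c : R) (u : R -> R -> R) :
  harmonic_on D u -> harmonic_on D (fun x y => c * u x y).
Proof.
  intros (u1 & u2 & u11 & u22 & Hu).
  exists (fun x y => c * u1 x y), (fun x y => c * u2 x y),
    (fun x y => c * u11 x y), (fun x y => c * u22 x y).
  intros x y Hxy. destruct (Hu x y Hxy) as (A1 & A2 & A3 & A4 & A5).
  refine (conj _ (conj _ (conj _ (conj _ _)))); try (apply is_derive_scal; assumption).
  rewrite <- Rmult_plus_distr_l, A5. ring.
Qed.

Lemma continuity_2d_open (w : R -> R -> R) (x y c : R) :
  continuity_2d_pt w x y -> w x y < c -> locally_2d (fun u v => w u v < c) x y.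
Proof.
  intros Hw Hc. assert (Hp : 0 < c - w x y) by lra.
  destruct (Hw (mkposreal _ Hp)) as [e He]. simpl in He. exists e. intros u v Hu Hv.
  specialize (He u v Hu Hv). apply Rabs_lt_between in He. lra.
Qed.

Lemma continuity_2d_normsq (x y : R) : continuity_2d_pt (fun u v => u * u + v * v) x y.
Proof.
  apply continuity_2d_pt_plus; apply continuity_2d_pt_mult;
    auto using continuity_2d_pt_id1, continuity_2d_pt_id2.
Qed.

Lemma closed_annulus (a b u v : R) :
  ~ (a <= u * u + v * v <= b) -> locally_2d (fun x y => ~ (a <= x * x + y * y <= b)) u v.
Proof.
  intros H. pose proof (continuity_2d_normsq u v) as C.
  destruct (Rlt_dec (u * u + v * v) a) as [Ha|Ha].
  - destruct (continuity_2d_open _ u v a C Ha) as [e He]. exists e.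
    intros x y Hx Hy. specialize (He x y Hx Hy). cbv beta in He. lra.
  - apply continuity_2d_pt_opp in C.
    destruct (continuity_2d_open _ u v (- b) C) as [e He]; [lra|]. exists e.
    intros x y Hx Hy. specialize (He x y Hx Hy). cbv beta in He. lra.
Qed.

(* Comparison on the annulus with the strictly subharmonic barrier [1/|z|^2 - 1],
   whose Laplacian is [4/|z|^4]. *)
Lemma hopf_barrier (v : R -> R -> R) :
  harmonic_on (fun x y => x * x + y * y < 1) v ->
  (forall x y, x * x + y * y <= 1 -> continuity_2d_pt v x y) ->
  (forall x y, x * x + y * y = 1 -> v x y <= 0) ->
  (forall x y, x * x + y * y < 1 -> v x y < 0) ->
  exists e : R, 0 < e /\ forall x y, 1/4 <= x * x + y * y <= 1 ->
    v x y <= - e * (/ (x * x + y * y) - 1).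
Proof.
  intros (v1 & v2 & v11 & v22 & Hv) Hc Hb Hi.
  destruct (square_max (fun x y => 0 <= x * x + y * y <= 1/4) v 0 0)
    as (xm & ym & Hm & Hmax).
  { intros x y H. nra. }
  { intros; now apply closed_annulus. }
  { intros x y H. apply Hc. lra. }
  { lra. }
  assert (Hneg : v xm ym < 0) by (apply Hi; lra).
  (* On the inner circle [|z|^2 = 1/4] the barrier equals [3], and there [v + 3 e] is at most a
     quarter of the negative maximum [v xm ym]. *)
  set (e := - v xm ym / 4). assert (He : 0 < e) by (unfold e; lra).
  exists e. split; auto.
  set (w := fun x y => v x y + e * (/ (x * x + y * y) - 1)).
  destruct (square_max (fun x y => 1/4 <= x * x + y * y <= 1) w 1 0)
    as (x1 & y1 & H1 & Hmax1).
  { intros x y H. nra. }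
  { intros; now apply closed_annulus. }
  { intros x y H. apply continuity_2d_pt_plus; [apply Hc; lra|].
    apply continuity_2d_pt_mult; [apply continuity_2d_pt_const|].
    apply continuity_2d_pt_minus; [|apply continuity_2d_pt_const].
    apply continuity_2d_pt_inv; [apply continuity_2d_normsq|lra]. }
  { lra. }
  (* The maximum of [w] is harmless on the outer circle, where the barrier vanishes, and on the
     inner one, by the choice of [e]. An interior maximum is excluded by the sign of the
     Laplacian. *)
  enough (Hw : w x1 y1 <= 0).
  { intros x y Hxy. specialize (Hmax1 x y Hxy). unfold w in *. lra. }
  destruct (Req_dec (x1 * x1 + y1 * y1) 1) as [E|E].
  { unfold w. rewrite E, Rinv_1. specialize (Hb x1 y1 E). lra. }
  destruct (Req_dec (x1 * x1 + y1 * y1) (1/4)) as [E'|E'].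
  { unfold w. rewrite E'. specialize (Hmax x1 y1 ltac:(lra)).
    replace (/ (1/4) - 1) with 3 by field. unfold e. lra. }
  exfalso.
  set (q := fun x y => x * x + y * y).
  assert (Hin : exists r : posreal, forall x y, Rabs (x - x1) < r -> Rabs (y - y1) < r ->
    1/4 < q x y < 1).
  { pose proof (continuity_2d_normsq x1 y1) as C.
    destruct (continuity_2d_open _ x1 y1 1 C) as [r1 Hr1]; [lra|].
    apply continuity_2d_pt_opp in C.
    destruct (continuity_2d_open _ x1 y1 (-(1/4)) C) as [r2 Hr2]; [lra|].
    exists (mkposreal _ (Rmin_stable_in_posreal r1 r2)). simpl. intros x y Hx Hy.
    pose proof (Rmin_l r1 r2). pose proof (Rmin_r r1 r2).
    specialize (Hr1 x y ltac:(lra) ltac:(lra)). specialize (Hr2 x y ltac:(lra) ltac:(lra)).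
    unfold q. cbv beta in *. lra. }
  destruct Hin as [r Hr].
  assert (R0 : forall c : R, Rabs (c - c) < r).
  { intros c. rewrite Rminus_diag, Rabs_R0. apply cond_pos. }
  pose proof (Hr x1 y1 (R0 x1) (R0 y1)) as Hq1. unfold q in Hq1, Hr.
  destruct (Hv x1 y1 ltac:(lra)) as (A1 & A2 & A3 & A4 & A5).
  set (Q := x1 * x1 + y1 * y1) in *.
  assert (Lx : v11 x1 y1 + e * (- 2 / Q ^ 2 + 8 * (x1 * x1) / Q ^ 3) <= 0).
  { apply (second_derivative_at_max (fun t => w t y1)
      (fun t => v1 t y1 + e * (- (2 * t) / (t * t + y1 * y1) ^ 2)) x1 _ r).
    - intros t Ht. specialize (Hr t y1 Ht (R0 y1)).
      destruct (Hv t y1 ltac:(lra)) as (B1 & _).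
      apply (is_derive_plus (fun t => v t y1) (fun t => e * (/ (t * t + y1 * y1) - 1))); auto.
      auto_derive; [lra|]. field. lra.
    - apply (is_derive_plus (fun t => v1 t y1) (fun t => e * (- (2 * t) / (t * t + y1 * y1) ^ 2))); auto.
      auto_derive; [|unfold Q; field; fold Q; lra].
      fold Q. rewrite Rmult_1_r. apply Rgt_not_eq. nra.
    - intros t Ht. apply Hmax1. specialize (Hr t y1 Ht (R0 y1)). lra. }
  assert (Ly : v22 x1 y1 + e * (- 2 / Q ^ 2 + 8 * (y1 * y1) / Q ^ 3) <= 0).
  { apply (second_derivative_at_max (fun t => w x1 t)
      (fun t => v2 x1 t + e * (- (2 * t) / (x1 * x1 + t * t) ^ 2)) y1 _ r).
    - intros t Ht. specialize (Hr x1 t (R0 x1) Ht).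
      destruct (Hv x1 t ltac:(lra)) as (_ & _ & B1 & _).
      apply (is_derive_plus (fun t => v x1 t) (fun t => e * (/ (x1 * x1 + t * t) - 1))); auto.
      auto_derive; [lra|]. field. lra.
    - apply (is_derive_plus (fun t => v2 x1 t) (fun t => e * (- (2 * t) / (x1 * x1 + t * t) ^ 2))); auto.
      auto_derive; [|unfold Q; field; fold Q; lra].
      fold Q. rewrite Rmult_1_r. apply Rgt_not_eq. nra.
    - intros t Ht. apply Hmax1. specialize (Hr x1 t (R0 x1) Ht). lra. }
  assert (Lap : (- 2 / Q ^ 2 + 8 * (x1 * x1) / Q ^ 3) + (- 2 / Q ^ 2 + 8 * (y1 * y1) / Q ^ 3)
                = 4 / Q ^ 2).
  { replace (x1 * x1) with (Q - y1 * y1) by (unfold Q; ring). field. lra. }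
  assert (0 < 4 / Q ^ 2) by (apply Rdiv_lt_0_compat; [lra|apply pow_lt; lra]).
  nra.
Qed.

(** * Holomorphic functions that are C^2 up to the boundary *)

Lemma Cmod_sqr (x y : R) : Cmod (x, y) ^ 2 = x * x + y * y.
Proof. rewrite Cmod2_alt. simpl. ring. Qed.

Lemma Cmod_lt_1 (x y : R) : Cmod (x, y) < 1 <-> x * x + y * y < 1.
Proof.
  rewrite <- Cmod_sqr. pose proof (Cmod_ge_0 (x, y)). split; intros; nra.
Qed.

Lemma Cmod_le_1 (x y : R) : Cmod (x, y) <= 1 <-> x * x + y * y <= 1.
Proof.
  rewrite <- Cmod_sqr. pose proof (Cmod_ge_0 (x, y)). split; intros; nra.
Qed.

Lemma Cmod_eq_1 (x y : R) : Cmod (x, y) = 1 <-> x * x + y * y = 1.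
Proof.
  rewrite <- Cmod_sqr. pose proof (Cmod_ge_0 (x, y)). split; intros; nra.
Qed.

Lemma open_disc (r x y : R) : Cmod (x, y) < r -> locally_2d (fun u v => Cmod (u, v) < r) x y.
Proof.
  intros H. pose proof (Cmod_ge_0 (x, y)) as H0.
  destruct (continuity_2d_open _ x y (r ^ 2) (continuity_2d_normsq x y)) as [e He].
  { rewrite <- Cmod_sqr. nra. }
  exists e. intros u v Hu Hv. specialize (He u v Hu Hv). cbv beta in He.
  rewrite <- Cmod_sqr in He. pose proof (Cmod_ge_0 (u, v)). nra.
Qed.

Lemma C_derive_expansion (phi : C -> C) (z l : C) :
  @is_derive C_AbsRing C_NormedModule phi z l ->
  forall e : posreal, exists d : posreal, forall u, Cmod (u - z) < d ->
    Cmod (phi u - phi z - (u - z) * l) <= e * Cmod (u - z).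
Proof.
  intros [_ H] e. destruct (H z (fun P HP => HP) e) as [d Hd].
  exists d. intros u Hu. exact (Hd u Hu).
Qed.

Lemma C_derive_axes (phi : C -> C) (x y : R) (l : C) :
  @is_derive C_AbsRing C_NormedModule phi (x, y) l ->
  is_derive (fun t => Re (phi (t, y))) x (Re l) /\
  is_derive (fun t => Im (phi (t, y))) x (Im l) /\
  is_derive (fun t => Re (phi (x, t))) y (- Im l) /\
  is_derive (fun t => Im (phi (x, t))) y (Re l).
Proof.
  intros H.
  (* One directional derivative covers all four cases: [k] is the direction ([1] or [Ci]), [L] the
     real or imaginary part, and the derivative is [L (k l)]. *)
  assert (G : forall (k : C) (p : R -> C) (s : R) (L : C -> R) (m : R), Cmod k = 1 ->
    (forall a b : C, L (a - b)%C = L a - L b) -> (forall a, Rabs (L a) <= Cmod a) ->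
    (forall t : R, L (RtoC t * k * l)%C = t * m) ->
    p s = (x, y) -> (forall h : R, (p (s + h)%R - p s)%C = (RtoC h * k)%C) ->
    is_derive (fun t => L (phi (p t))) s m).
  { intros k p s L m Hk HL HLm Hlin Hps Hp.
    apply is_derive_Reals. intros e He.
    assert (He2 : 0 < e / 2) by lra.
    destruct (C_derive_expansion phi (x, y) l H (mkposreal _ He2)) as [d Hd].
    exists d. intros h Hh0 Hh. rewrite <- Hps in Hd. specialize (Hd (p (s + h))).
    rewrite Hp, Cmod_mult, Cmod_R, Hk, Rmult_1_r in Hd. specialize (Hd Hh). simpl in Hd.
    eapply Rle_trans in Hd; [|apply HLm].
    rewrite !HL, Hlin in Hd.
    replace ((L (phi (p (s + h))) - L (phi (p s))) / h - m)
      with ((L (phi (p (s + h))) - L (phi (p s)) - h * m) / h) by (field; auto).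
    unfold Rdiv. rewrite Rabs_mult, Rabs_inv.
    assert (Hah : 0 < Rabs h) by now apply Rabs_pos_lt.
    apply Rmult_lt_reg_r with (Rabs h); auto. rewrite Rmult_assoc, Rinv_l by lra. nra. }
  assert (R1 : forall a b : C, Re (a - b)%C = Re a - Re b) by (intros; reflexivity).
  assert (I1 : forall a b : C, Im (a - b)%C = Im a - Im b) by (intros; reflexivity).
  refine (conj _ (conj _ (conj _ _))).
  - apply (G (RtoC 1) (fun t => (t, y)) x Re); auto using Cmod_1, re_le_Cmod.
    + intros t. destruct l. simpl. ring.
    + intros h. apply injective_projections; simpl; ring.
  - apply (G (RtoC 1) (fun t => (t, y)) x Im); auto using Cmod_1, Rabs_Im_le_Cmod.
    + intros t. destruct l. simpl. ring.
    + intros h. apply injective_projections; simpl; ring.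
  - apply (G Ci (fun t => (x, t)) y Re); auto using Cmod_Ci, re_le_Cmod.
    + intros t. destruct l. simpl. ring.
    + intros h. apply injective_projections; simpl; ring.
  - apply (G Ci (fun t => (x, t)) y Im); auto using Cmod_Ci, Rabs_Im_le_Cmod.
    + intros t. destruct l. simpl. ring.
    + intros h. apply injective_projections; simpl; ring.
Qed.

(** The Laplacian of [P] is [c] times the difference of the mixed derivatives of [Q], zero by
    Schwarz. The sign [c] lets one statement treat the real part ([c = 1]) and the imaginary part
    ([c = -1]). *)
Lemma harmonic_of_Cauchy_Riemann (c r : R) (P Q : R -> R -> R) :
  1 <= r -> C2_on_disc r P -> C2_on_disc r Q ->
  (forall x y, Cmod (x, y) < 1 ->
     Derive (fun t => P t y) x = c * Derive (fun t => Q x t) y /\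
     Derive (fun t => P x t) y = - c * Derive (fun t => Q t y) x) ->
  harmonic_on (fun x y => x * x + y * y < 1) P.
Proof.
  intros Hr HP HQ CR.
  exists (fun x y => Derive (fun t => P t y) x), (fun x y => Derive (fun t => P x t) y),
    (fun x y => Derive (fun s => Derive (fun t => P t y) s) x),
    (fun x y => Derive (fun s => Derive (fun t => P x t) s) y).
  intros x y Hxy. apply Cmod_lt_1 in Hxy.
  destruct (HP x y ltac:(lra)) as (_ & D1 & D2 & (_ & D11 & _) & (_ & _ & D22 & _)).
  refine (conj _ (conj _ (conj _ (conj _ _)))); try (apply Derive_correct; assumption).
  destruct (open_disc 1 x y Hxy) as [e He].
  assert (R0 : forall a : R, Rabs (a - a) < e).
  { intros a. rewrite Rminus_diag, Rabs_R0. apply cond_pos. }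
  assert (X1 : Derive (fun s : R => Derive (fun t => P t y) s) x
               = Derive (fun s : R => c * Derive (fun t => Q s t) y) x).
  { apply Derive_ext_loc. exists e. intros s Hs. apply CR. apply He; auto. }
  assert (X2 : Derive (fun s : R => Derive (fun t => P x t) s) y
               = Derive (fun s : R => - c * Derive (fun t => Q t s) x) y).
  { apply Derive_ext_loc. exists e. intros s Hs. apply CR. apply He; auto. }
  cbv beta. rewrite X1, X2.
  rewrite !Derive_scal, (Schwarz Q x y).
  - ring.
  - exists e. intros u v Hu Hv. specialize (He u v Hu Hv).
    destruct (HQ u v ltac:(lra)) as (_ & E1 & E2 & (_ & _ & E12 & _) & (_ & E21 & _)).
    auto.
  - destruct (HQ x y ltac:(lra)) as (_ & _ & _ & _ & (_ & _ & _ & (E & _) & _)). exact E.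
  - destruct (HQ x y ltac:(lra)) as (_ & _ & _ & (_ & _ & _ & _ & (E & _)) & _). exact E.
Qed.

(** Approach the boundary point radially, through [(1 - t) (a, b)]. It carries the Cauchy-Riemann
    equations from the open disc to the circle. *)
Lemma boundary_value_0 (G : R -> R -> R) (a b : R) :
  a * a + b * b = 1 -> continuity_2d_pt G a b ->
  (forall x y, x * x + y * y < 1 -> G x y = 0) -> G a b = 0.
Proof.
  intros Hab Hc H0. apply NNPP. intros N.
  assert (Hp : 0 < Rabs (G a b)) by now apply Rabs_pos_lt.
  destruct (Hc (mkposreal _ Hp)) as [e He]. simpl in He.
  set (t := Rmin e 1 / 2).
  assert (Ht : 0 < t < e /\ t < 1).
  { pose proof (cond_pos e). pose proof (Rmin_l e 1). pose proof (Rmin_r e 1).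
    assert (0 < Rmin e 1) by (apply Rmin_glb_lt; lra). unfold t; lra. }
  assert (Hsmall : forall c, c * c <= 1 -> Rabs ((1 - t) * c - c) < e).
  { intros c Hc1. replace ((1 - t) * c - c) with (- (t * c)) by ring.
    rewrite Rabs_Ropp, Rabs_mult, (Rabs_pos_eq t) by lra.
    assert (Rabs c <= 1) by (apply Rabs_le; split; nra). pose proof (Rabs_pos c). nra. }
  specialize (He ((1 - t) * a) ((1 - t) * b) (Hsmall a ltac:(nra)) (Hsmall b ltac:(nra))).
  rewrite H0 in He.
  2:{ replace ((1 - t) * a * ((1 - t) * a) + (1 - t) * b * ((1 - t) * b))
        with ((1 - t) * (1 - t) * (a * a + b * b)) by ring. rewrite Hab. nra. }
  replace (0 - G a b) with (- G a b) in He by ring. rewrite Rabs_Ropp in He. lra.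
Qed.

Lemma C2_expansion (r : R) (P : R -> R -> R) (x y : R) :
  C2_on_disc r P -> Cmod (x, y) < r ->
  exists D, 0 <= D /\ locally_2d (fun u v =>
    Rabs (P u v - P x y - Derive (fun t => P t y) x * (u - x) - Derive (fun t => P x t) y * (v - y))
    <= D * Cmod (u - x, v - y) ^ 2) x y.
Proof.
  intros HP Hxy.
  destruct (Taylor_Lagrange_2d P 1 x y) as [D [e He]].
  { destruct (open_disc r x y Hxy) as [e He]. exists e. intros u v Hu Hv. apply HP; auto. }
  exists (Rabs D). split; [apply Rabs_pos|]. exists e. intros u v Hu Hv.
  specialize (He u v Hu Hv).
  replace (P u v - P x y - Derive (fun t => P t y) x * (u - x) - Derive (fun t => P x t) y * (v - y))
    with (P u v - DL_pol 1 P x y (u - x) (v - y)).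
  2:{ unfold DL_pol, differential, partial_derive, Binomial.C. simpl. field. }
  eapply Rle_trans; [exact He|].
  pose proof (Rmax_Cmod (u - x, v - y)) as Hm. simpl fst in Hm. simpl snd in Hm.
  assert (0 <= Rmax (Rabs (u - x)) (Rabs (v - y))).
  { eapply Rle_trans; [apply (Rabs_pos (u - x))|apply Rmax_l]. }
  apply Rle_trans with (Rabs D * Rmax (Rabs (u - x)) (Rabs (v - y)) ^ 2).
  - apply Rmult_le_compat_r; [apply pow2_ge_0|apply Rle_abs].
  - apply Rmult_le_compat_l; [apply Rabs_pos|]. apply pow_incr. lra.
Qed.

(** Regularity is two-sided around the circle while holomorphy is required only inside; thus partial
    derivatives at boundary points are ordinary ones. *)
Definition holo_C2 (F : C -> C) : Prop :=
  exists r, 1 < r /\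
    C2_on_disc r (fun a b => Re (F (a, b))) /\ C2_on_disc r (fun a b => Im (F (a, b))) /\
    forall z, in_disc z -> @ex_derive C_AbsRing C_NormedModule F z.

Lemma holo_C2_Cauchy_Riemann (F : C -> C) (x y : R) :
  holo_C2 F -> Cmod (x, y) <= 1 ->
  Derive (fun t => Re (F (t, y))) x = Derive (fun t => Im (F (x, t))) y /\
  Derive (fun t => Re (F (x, t))) y = - Derive (fun t => Im (F (t, y))) x.
Proof.
  intros (r & Hr & HP & HQ & HF).
  assert (CR : forall x y, Cmod (x, y) < 1 ->
    Derive (fun t => Re (F (t, y))) x = Derive (fun t => Im (F (x, t))) y /\
    Derive (fun t => Re (F (x, t))) y = - Derive (fun t => Im (F (t, y))) x).
  { intros a b Hab. destruct (HF (a, b) Hab) as [l Hl].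
    destruct (C_derive_axes F a b l Hl) as (A1 & A2 & A3 & A4).
    apply is_derive_unique in A1, A2, A3, A4. split.
    - transitivity (Re l); [exact A1|symmetry; exact A4].
    - transitivity (- Im l); [exact A3|f_equal; symmetry; exact A2]. }
  intros [Hlt|Heq]; [auto|].
  destruct (HP x y ltac:(lra)) as (_ & _ & _ & (P1 & _) & (P2 & _)).
  destruct (HQ x y ltac:(lra)) as (_ & _ & _ & (Q1 & _) & (Q2 & _)).
  apply Cmod_eq_1 in Heq.
  pose proof (boundary_value_0 _ x y Heq (continuity_2d_pt_minus _ _ _ _ P1 Q2)) as B1.
  pose proof (boundary_value_0 _ x y Heq (continuity_2d_pt_plus _ _ _ _ P2 Q1)) as B2.
  cbv beta in B1, B2. split.
  - apply Rminus_diag_uniq, B1. intros u v Huv. apply Cmod_lt_1 in Huv.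
    destruct (CR u v Huv) as [-> _]. ring.
  - apply Rminus_diag_uniq. unfold Rminus. rewrite Ropp_involutive.
    apply B2. intros u v Huv. apply Cmod_lt_1 in Huv.
    destruct (CR u v Huv) as [_ ->]. ring.
Qed.

Lemma holo_C2_harmonic (F : C -> C) : holo_C2 F ->
  harmonic_on (fun x y => x * x + y * y < 1) (fun a b => Re (F (a, b))) /\
  harmonic_on (fun x y => x * x + y * y < 1) (fun a b => Im (F (a, b))).
Proof.
  intros HF. pose proof HF as (r & Hr & HP & HQ & _). split.
  - apply (harmonic_of_Cauchy_Riemann 1 r _ (fun a b => Im (F (a, b)))); auto; [lra|].
    intros x y Hxy. destruct (holo_C2_Cauchy_Riemann F x y HF) as [-> ->]; lra.
  - apply (harmonic_of_Cauchy_Riemann (-1) r _ (fun a b => Re (F (a, b)))); auto; [lra|].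
    intros x y Hxy. destruct (holo_C2_Cauchy_Riemann F x y HF) as [-> ->]; lra.
Qed.

Lemma holo_C2_continuity (F : C -> C) (x y : R) : holo_C2 F -> Cmod (x, y) <= 1 ->
  continuity_2d_pt (fun a b => Re (F (a, b))) x y /\
  continuity_2d_pt (fun a b => Im (F (a, b))) x y.
Proof.
  intros (r & Hr & HP & HQ & _) Hxy. split.
  - destruct (HP x y ltac:(lra)) as [E _]. exact E.
  - destruct (HQ x y ltac:(lra)) as [E _]. exact E.
Qed.

(** The Cauchy-Riemann equations at [xi] turn the real linear part of Taylor's formula into
    multiplication by the complex number [L]. The estimate holds in a full neighbourhood, on both
    sides of the circle. *)
Lemma holo_C2_expansion (F : C -> C) (xi : C) :
  holo_C2 F -> Cmod xi = 1 ->
  exists (L : C) (M e : R), 0 <= M /\ 0 < e /\ forall z, Cmod (z - xi) < e ->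
    Cmod (F z - F xi - L * (z - xi)) <= M * Cmod (z - xi) ^ 2.
Proof.
  intros HF Hxi. pose proof HF as (r & Hr & HP & HQ & _). destruct xi as [x y].
  destruct (C2_expansion r _ x y HP ltac:(lra)) as (D1 & HD1 & e1 & He1).
  destruct (C2_expansion r _ x y HQ ltac:(lra)) as (D2 & HD2 & e2 & He2).
  destruct (holo_C2_Cauchy_Riemann F x y HF ltac:(lra)) as [CR1 CR2].
  rewrite CR2 in He1. rewrite <- CR1 in He2.
  set (p := Derive (fun t => Re (F (t, y))) x) in *.
  set (q := Derive (fun t => Im (F (t, y))) x) in *.
  exists (p, q), (D1 + D2), (Rmin e1 e2). split; [lra|]. split.
  { apply Rmin_glb_lt; apply cond_pos. }
  intros [u v] Hz.
  pose proof (Rmin_l e1 e2). pose proof (Rmin_r e1 e2).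
  pose proof (re_le_Cmod ((u, v) - (x, y))%C) as H1.
  pose proof (Rabs_Im_le_Cmod ((u, v) - (x, y))%C) as H2.
  unfold Re in H1. unfold Im in H2. simpl fst in H1. simpl snd in H2.
  change (u + - x) with (u - x) in H1. change (v + - y) with (v - y) in H2.
  specialize (He1 u v ltac:(lra) ltac:(lra)). specialize (He2 u v ltac:(lra) ltac:(lra)).
  cbv beta in He1, He2.
  change (u - x, v - y) with ((u, v) - (x, y))%C in He1, He2.
  eapply Rle_trans; [apply Cmod_le_abs_sum|].
  rewrite Rmult_plus_distr_r. apply Rplus_le_compat.
  - eapply Rle_trans; [|exact He1]. right. f_equal. unfold Re, Im. simpl. ring.
  - eapply Rle_trans; [|exact He2]. right. f_equal. unfold Re, Im. simpl. ring.
Qed.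

(** * Boundary behaviour of embedding maps *)

Lemma cinner_expansion (n : nat) (F : C -> nat -> C) (p : nat -> C) (xi : C) :
  (forall i, (i < n)%nat -> holo_C2 (fun z => F z i)) -> Cmod xi = 1 ->
  exists (L : C) (M e : R), 0 <= M /\ 0 < e /\ forall z, Cmod (z - xi) < e ->
    Cmod (cinner n (F z) p - cinner n (F xi) p - L * (z - xi)) <= M * Cmod (z - xi) ^ 2 /\
    forall i, (i < n)%nat -> Cmod (F z i - F xi i) <= M * Cmod (z - xi).
Proof.
  intros HF Hxi. induction n as [|n IH].
  - exists (RtoC 0), 0, 1. split; [lra|]. split; [lra|]. intros z _. split; [|lia].
    unfold cinner. simpl csum.
    replace (0 - 0 - 0 * (z - xi))%C with (RtoC 0) by ring. rewrite Cmod_0. lra.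
  - destruct IH as (L & M & e & HM & He & H); [auto with arith|].
    destruct (holo_C2_expansion _ xi (HF n ltac:(lia)) Hxi) as (L1 & M1 & e1 & HM1 & He1 & H1).
    pose proof (Cmod_ge_0 (p n)) as Hp. pose proof (Cmod_ge_0 L1) as HL1.
    (* The first two summands of the constant serve the quadratic error, [Cmod L1 + M1] the
       Lipschitz bound; the radius is capped at [1] so that [r ^ 2 <= r]. *)
    exists (L + L1 * Cconj (p n))%C, (M + M1 * Cmod (p n) + Cmod L1 + M1), (Rmin (Rmin e e1) 1).
    assert (0 <= M1 * Cmod (p n)) by nra.
    split; [lra|]. split; [repeat apply Rmin_glb_lt; lra|]. intros z Hz.
    pose proof (Rmin_l (Rmin e e1) 1). pose proof (Rmin_r (Rmin e e1) 1).
    pose proof (Rmin_l e e1). pose proof (Rmin_r e e1).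
    destruct (H z ltac:(lra)) as [Ha Hb]. specialize (H1 z ltac:(lra)). cbv beta in H1.
    pose proof (Cmod_ge_0 (z - xi)) as Hd. set (r := Cmod (z - xi)) in *. split.
    + unfold cinner in *. cbn [csum].
      set (S1 := csum n (fun i => F z i * Cconj (p i))%C) in *.
      set (S2 := csum n (fun i => F xi i * Cconj (p i))%C) in *.
      replace (S1 + F z n * Cconj (p n) - (S2 + F xi n * Cconj (p n))
               - (L + L1 * Cconj (p n)) * (z - xi))%C
        with ((S1 - S2 - L * (z - xi)) + (F z n - F xi n - L1 * (z - xi)) * Cconj (p n))%C
        by ring.
      eapply Rle_trans; [apply Cmod_triangle|]. rewrite Cmod_mult, Cmod_conj.
      assert (Cmod (F z n - F xi n - L1 * (z - xi)) * Cmod (p n) <= M1 * r ^ 2 * Cmod (p n))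
        by (apply Rmult_le_compat_r; lra).
      assert (0 <= r ^ 2) by apply pow2_ge_0. nra.
    + intros i Hi. destruct (Nat.eq_dec i n) as [->|Hin].
      * replace (F z n - F xi n)%C
          with ((F z n - F xi n - L1 * (z - xi)) + L1 * (z - xi))%C by ring.
        eapply Rle_trans; [apply Cmod_triangle|]. rewrite Cmod_mult. fold r.
        assert (r ^ 2 <= r) by nra.
        assert (M1 * r ^ 2 <= M1 * r) by (apply Rmult_le_compat_l; lra).
        nra.
      * specialize (Hb i ltac:(lia)). nra.
Qed.

Lemma Re_cinner_harmonic (n : nat) (F : C -> nat -> C) (p : nat -> C) :
  (forall i, (i < n)%nat -> holo_C2 (fun z => F z i)) ->
  harmonic_on (fun x y => x * x + y * y < 1) (fun x y => Re (cinner n (F (x, y)) p)).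
Proof.
  intros HF. induction n as [|n IH]; [apply (harmonic_const _ 0)|].
  destruct (holo_C2_harmonic _ (HF n ltac:(lia))) as [H1 H2].
  replace (fun x y => Re (cinner (S n) (F (x, y)) p)) with
    (fun x y => Re (cinner n (F (x, y)) p)
      + (Re (p n) * Re (F (x, y) n) + Im (p n) * Im (F (x, y) n))).
  - apply (harmonic_plus _ (fun x y => Re (cinner n (F (x, y)) p))); [auto with arith|].
    apply (harmonic_plus _ (fun x y => Re (p n) * Re (F (x, y) n)));
      apply harmonic_scal; assumption.
  - apply functional_extensionality; intros x. apply functional_extensionality; intros y.
    unfold cinner. cbn [csum]. rewrite re_plus. f_equal.
    rewrite re_mult, re_conj, im_conj. ring.
Qed.

Lemma Re_cinner_continuity (n : nat) (F : C -> nat -> C) (p : nat -> C) (x y : R) :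
  (forall i, (i < n)%nat -> holo_C2 (fun z => F z i)) -> Cmod (x, y) <= 1 ->
  continuity_2d_pt (fun x y => Re (cinner n (F (x, y)) p)) x y.
Proof.
  intros HF Hxy. induction n as [|n IH]; [apply (continuity_2d_pt_const x y 0)|].
  destruct (holo_C2_continuity _ x y (HF n ltac:(lia)) Hxy) as [H1 H2].
  apply continuity_2d_pt_ext with (fun x y => Re (cinner n (F (x, y)) p)
      + (Re (p n) * Re (F (x, y) n) + Im (p n) * Im (F (x, y) n))).
  - intros a b. unfold cinner. cbn [csum]. rewrite re_plus. f_equal.
    rewrite re_mult, re_conj, im_conj. ring.
  - apply continuity_2d_pt_plus; [auto with arith|].
    apply continuity_2d_pt_plus;
      (apply continuity_2d_pt_mult; [apply continuity_2d_pt_const|assumption]).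
Qed.

(** Here [A = xi L] with [L] the derivative of [<F, F xi>] at [xi]. The Hopf barrier forces
    [Re A >= c > 0]: at [s = t] it gives [1 - t Re A - M t^2 <= 1 - 2 c t], and [t] is chosen with
    [M t <= c]. *)
Lemma boundary_expansion (d : nat) (F : C -> nat -> C) (xi : C) :
  (forall i, (i < d)%nat -> holo_C2 (fun z => F z i)) ->
  (forall z, in_disc z -> vnorm d (F z) < 1) ->
  (forall z, Cmod z = 1 -> vnorm d (F z) = 1) ->
  Cmod xi = 1 ->
  exists (A : C) (M e : R), 0 < Re A /\ 0 <= M /\ 0 < e /\ forall s : C, Cmod s < e ->
    Cmod (cinner d (F (xi * (1 - s))%C) (F xi) - (1 - A * s)) <= M * Cmod s ^ 2 /\
    forall i, (i < d)%nat -> Cmod (F (xi * (1 - s))%C i - F xi i) <= M * Cmod s.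
Proof.
  intros HF Hball Hsph Hxi.
  destruct (cinner_expansion d F (F xi) xi HF Hxi) as (L & M & e & HM & He & H).
  assert (Hself : cinner d (F xi) (F xi) = RtoC 1).
  { rewrite cinner_self, Hsph by auto. now rewrite pow1. }
  assert (Hdiff : forall s, (xi * (1 - s) - xi = - (xi * s))%C) by (intros; ring).
  assert (Hs : forall s, Cmod s < e ->
    Cmod (cinner d (F (xi * (1 - s))%C) (F xi) - (1 - L * xi * s)) <= M * Cmod s ^ 2 /\
    forall i, (i < d)%nat -> Cmod (F (xi * (1 - s))%C i - F xi i) <= M * Cmod s).
  { intros s Hs. specialize (H (xi * (1 - s))%C).
    rewrite Hdiff, Cmod_opp, Cmod_mult, Hxi, Rmult_1_l, Hself in H.
    destruct (H Hs) as [Ha Hb]. split; auto.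
    replace (cinner d (F (xi * (1 - s))%C) (F xi) - (1 - L * xi * s))%C
      with (cinner d (F (xi * (1 - s))%C) (F xi) - 1 - L * - (xi * s))%C by ring.
    exact Ha. }
  exists (L * xi)%C, M, e. split; [|auto].
  assert (Hre : forall z, Re (cinner d (F z) (F xi)) <= vnorm d (F z)).
  { intros z. eapply Rle_trans; [apply Re_le_Cmod|].
    eapply Rle_trans; [apply cinner_mod_le|]. rewrite (Hsph xi Hxi). lra. }
  destruct (hopf_barrier (fun x y => Re (cinner d (F (x, y)) (F xi)) + -1)) as (c & Hc & Hbar).
  { apply (harmonic_plus _ (fun x y => Re (cinner d (F (x, y)) (F xi))));
      [now apply Re_cinner_harmonic|apply harmonic_const]. }
  { intros x y Hxy. apply Cmod_le_1 in Hxy.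
    apply continuity_2d_pt_plus; [now apply Re_cinner_continuity|apply continuity_2d_pt_const]. }
  { intros x y Hxy. apply Cmod_eq_1 in Hxy. specialize (Hre (x, y)).
    rewrite (Hsph (x, y) Hxy) in Hre. lra. }
  { intros x y Hxy. apply Cmod_lt_1 in Hxy. specialize (Hre (x, y)).
    specialize (Hball (x, y) Hxy). lra. }
  (* The three caps keep [t] inside the range of the expansion, keep the point in the annulus of the
     barrier, and ensure [M t <= c]. *)
  set (t := Rmin (Rmin (e / 2) (1 / 4)) (c / (M + 1))).
  assert (Hcm : 0 < c / (M + 1)) by (apply Rdiv_lt_0_compat; lra).
  assert (Ht : 0 < t /\ t <= e / 2 /\ t <= 1 / 4 /\ t <= c / (M + 1)).
  { pose proof (Rmin_l (Rmin (e / 2) (1 / 4)) (c / (M + 1))).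
    pose proof (Rmin_r (Rmin (e / 2) (1 / 4)) (c / (M + 1))).
    pose proof (Rmin_l (e / 2) (1 / 4)). pose proof (Rmin_r (e / 2) (1 / 4)).
    fold t in H0, H1. split; [|lra]. unfold t. repeat apply Rmin_glb_lt; lra. }
  destruct Ht as (Ht0 & Ht1 & Ht2 & Ht3).
  assert (HMt : M * t <= c).
  { apply Rle_trans with ((M + 1) * (c / (M + 1))); [nra|]. right. field. lra. }
  assert (Hmt : Cmod (RtoC t) = t) by (rewrite Cmod_R; apply Rabs_pos_eq; lra).
  destruct (Hs (RtoC t)) as [Hexp _]; [lra|]. rewrite Hmt in Hexp.
  set (z := (xi * (1 - RtoC t))%C) in *.
  assert (Hz : Cmod z = 1 - t).
  { unfold z. rewrite Cmod_mult, Hxi, <- RtoC_minus, Cmod_R, Rabs_pos_eq; lra. }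
  clearbody z. destruct z as [x y].
  assert (Hq : x * x + y * y = (1 - t) ^ 2) by (rewrite <- Cmod_sqr, Hz; reflexivity).
  specialize (Hbar x y). rewrite Hq in Hbar. specialize (Hbar ltac:(nra)).
  assert (Hinv : 2 * t <= / (1 - t) ^ 2 - 1).
  { assert (0 < (1 - t) ^ 2) by (apply pow_lt; lra).
    assert (1 + 2 * t <= / (1 - t) ^ 2); [|lra].
    apply Rmult_le_reg_r with ((1 - t) ^ 2); auto. rewrite Rinv_l by lra. nra. }
  assert (Hlow : 1 - t * Re (L * xi)%C - M * t ^ 2 <= Re (cinner d (F (x, y)) (F xi))).
  { pose proof (re_le_Cmod (cinner d (F (x, y)) (F xi) - (1 - L * xi * RtoC t))%C) as Hr.
    apply Rabs_le_between in Hr.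
    assert (E : forall u w : C, Re (u - (1 - w * RtoC t))%C = Re u - (1 - Re w * t))
      by (intros [] []; simpl; ring).
    rewrite E in Hr. lra. }
  assert (c * (2 * t) <= c * (/ (1 - t) ^ 2 - 1)) by (apply Rmult_le_compat_l; lra).
  assert (0 <= t * (Re (L * xi)%C - c)) by nra.
  assert (0 <= Re (L * xi)%C - c); [|lra].
  apply Rmult_le_reg_l with t; lra.
Qed.

Lemma embedding_ball (d : nat) (V : (nat -> C) -> Prop) (f : C -> nat -> C) (z : C) :
  embedding_map d V f -> in_disc z -> vnorm d (f z) < 1.
Proof.
  intros ((S & _ & HV) & _ & _ & _ & Him & _) Hz.
  assert (HVz : V (f z)) by (apply Him; now exists z).
  now destruct (proj1 (HV _) HVz) as [[_ H] _].
Qed.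

Lemma embedding_extension (d : nat) (V : (nat -> C) -> Prop) (f : C -> nat -> C) :
  embedding_map d V f ->
  exists F : C -> nat -> C, (forall x, Cmod x <= 1 -> F x = f x) /\
    forall i, (i < d)%nat -> holo_C2 (fun z => F z i).
Proof.
  intros (_ & _ & _ & Hder & _ & (r & F & Hr & HF & HC2) & _).
  exists F. split; auto. intros i Hi. destruct (HC2 i Hi) as [HP HQ].
  exists r. split; [lra|]. split; [exact HP|]. split; [exact HQ|].
  intros z Hz. destruct (Hder z Hz) as [Hd _].
  apply ex_derive_ext_loc with (fun u : C => f u i); [|now apply Hd].
  assert (Hp : 0 < 1 - Cmod z) by (unfold in_disc in Hz; lra).
  exists (mkposreal _ Hp). intros u Hu.
  change (Cmod (u - z) < 1 - Cmod z) in Hu. rewrite HF; auto.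
  replace u with ((u - z) + z)%C by ring.
  pose proof (Cmod_triangle (u - z) z). lra.
Qed.

(** A path parametrised so that [<f (gam t), f xi>] is [1 - t] to first order, with no trace of the
    derivative at [xi]. Paths at two boundary points are thereby synchronised. *)
Lemma boundary_approach (d : nat) (V : (nat -> C) -> Prop) (f : C -> nat -> C) (xi : C) :
  embedding_map d V f -> Cmod xi = 1 ->
  exists (gam : R -> C) (M tau : R), 0 <= M /\ 0 < tau /\ forall t, 0 < t < tau ->
    in_disc (gam t) /\ Cmod (gam t - xi) <= M * t /\
    Cmod (cinner d (f (gam t)) (f xi) - (1 - RtoC t)) <= M * t ^ 2 /\
    forall i, (i < d)%nat -> Cmod (f (gam t) i - f xi i) <= M * t.
Proof.
  intros Hf Hxi.
  destruct (embedding_extension d V f Hf) as (F & HF & Hholo).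
  pose proof Hf as (_ & _ & _ & _ & _ & _ & Hn).
  destruct (boundary_expansion d F xi) as (A & M & e & HA & HM & He & H); auto.
  { intros z Hz. rewrite HF by (unfold in_disc in Hz; lra). now apply (embedding_ball d V). }
  { intros z Hz. rewrite HF by lra. apply Hn; lra. }
  assert (HA0 : A <> RtoC 0) by (intros E; rewrite E in HA; simpl in HA; lra).
  assert (Ha : 0 < Cmod A) by now apply Cmod_gt_0.
  set (a := / Cmod A). assert (Ha' : 0 < a) by now apply Rinv_0_lt_compat.
  (* For [t > 0], [|A - t| < |A|] exactly when [t < 2 Re A], which keeps the path in the disc;
     [a t = |t / A|] must also stay below [e]. *)
  exists (fun t => xi * (1 - RtoC t / A))%C, (M * a ^ 2 + M * a + a), (Rmin (2 * Re A) (e / a)).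
  assert (0 <= M * a) by (apply Rmult_le_pos; lra).
  assert (0 <= M * a ^ 2) by (apply Rmult_le_pos; [lra|apply pow2_ge_0]).
  split; [lra|]. split.
  { apply Rmin_glb_lt; [lra|]. now apply Rdiv_lt_0_compat. }
  intros t [Ht0 Ht].
  pose proof (Rmin_l (2 * Re A) (e / a)). pose proof (Rmin_r (2 * Re A) (e / a)).
  assert (Hmod : Cmod (RtoC t / A) = t * a).
  { rewrite Cmod_div, Cmod_R, Rabs_pos_eq by (auto; lra). reflexivity. }
  assert (Hsmall : Cmod (RtoC t / A) < e).
  { rewrite Hmod. replace e with (e / a * a) by (field; lra).
    apply Rmult_lt_compat_r; lra. }
  assert (Hin : in_disc (xi * (1 - RtoC t / A))%C).
  { unfold in_disc. rewrite Cmod_mult, Hxi, Rmult_1_l.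
    replace (1 - RtoC t / A)%C with ((A - RtoC t) / A)%C by (field; auto).
    rewrite Cmod_div by auto. apply Rmult_lt_reg_r with (Cmod A); auto.
    unfold Rdiv. rewrite Rmult_assoc, Rinv_l, Rmult_1_r, Rmult_1_l by lra.
    pose proof (Cmod2_alt A) as E1. pose proof (Cmod2_alt (A - RtoC t)) as E2.
    pose proof (Cmod_ge_0 (A - RtoC t)).
    assert (E3 : Re (A - RtoC t)%C = Re A - t) by (destruct A; simpl; ring).
    assert (E4 : Im (A - RtoC t)%C = Im A) by (destruct A; simpl; ring).
    rewrite E3, E4 in E2. nra. }
  destruct (H _ Hsmall) as [E1 E2]. rewrite Hmod in E1, E2.
  rewrite (HF xi) in E1, E2 by lra.
  rewrite HF in E1, E2 by (unfold in_disc in Hin; lra).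
  split; [exact Hin|]. split; [|split].
  - replace (xi * (1 - RtoC t / A) - xi)%C with (- (xi * (RtoC t / A)))%C by ring.
    rewrite Cmod_opp, Cmod_mult, Hxi, Hmod. nra.
  - replace (A * (RtoC t / A))%C with (RtoC t) in E1 by (field; auto).
    eapply Rle_trans; [exact E1|].
    assert (0 <= t ^ 2) by apply pow2_ge_0. nra.
  - intros i Hi. eapply Rle_trans; [apply E2; auto|]. nra.
Qed.

(** * Kernel asymptotics at a crossing, and the transfer of crossings *)

(** Expand around [p]: [<x, y> = <x - p, y - p> + <x, p> + <p, y> - <p, p>]. The two middle terms
    give [2 - 2t] up to [2 M t^2], and the first is at most [d M^2 t^2] by the Lipschitz bounds. *)
Lemma cinner_near (d : nat) (x y p : nat -> C) (M t : R) :
  cinner d p p = RtoC 1 -> 0 <= M -> 0 < t ->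
  Cmod (cinner d x p - (1 - RtoC t)) <= M * t ^ 2 ->
  Cmod (cinner d y p - (1 - RtoC t)) <= M * t ^ 2 ->
  (forall i, (i < d)%nat -> Cmod (x i - p i) <= M * t) ->
  (forall i, (i < d)%nat -> Cmod (y i - p i) <= M * t) ->
  Cmod (1 - cinner d x y - RtoC (2 * t)) <= (2 * M + INR d * M ^ 2) * t ^ 2.
Proof.
  intros Hp HM Ht Hx Hy Hx' Hy'.
  assert (E : cinner d x y = (cinner d (fun i => x i - p i)%C (fun i => y i - p i)%C
    + cinner d x p + Cconj (cinner d y p) - cinner d p p)%C).
  { rewrite <- (cinner_conj d p y). unfold cinner.
    rewrite <- !csum_plus, <- csum_minus. apply csum_ext. intros i _.
    rewrite Cminus_conj. ring. }
  set (u := (cinner d x p - (1 - RtoC t))%C) in *.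
  set (v := (cinner d y p - (1 - RtoC t))%C) in *.
  set (q := cinner d (fun i => x i - p i)%C (fun i => y i - p i)%C) in *.
  assert (Eu : cinner d x p = (u + (1 - RtoC t))%C) by (unfold u; ring).
  assert (Ev : Cconj (cinner d y p) = (Cconj v + (1 - RtoC t))%C).
  { replace (cinner d y p) with (v + (1 - RtoC t))%C by (unfold v; ring).
    rewrite Cplus_conj, <- RtoC_minus. f_equal. unfold Cconj; simpl; now rewrite Ropp_0. }
  rewrite E, Eu, Ev, Hp, RtoC_mult.
  replace (1 - (q + (u + (1 - RtoC t)) + (Cconj v + (1 - RtoC t)) - 1) - RtoC 2 * RtoC t)%C
    with (- (q + u + Cconj v))%C by ring.
  rewrite Cmod_opp.
  assert (Hq : Cmod q <= INR d * (M ^ 2 * t ^ 2)).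
  { apply csum_mod_le. intros i Hi. rewrite Cmod_mult, Cmod_conj.
    specialize (Hx' i Hi). specialize (Hy' i Hi).
    replace (M ^ 2 * t ^ 2) with ((M * t) * (M * t)) by ring.
    apply Rmult_le_compat; auto using Cmod_ge_0. }
  pose proof (Cmod_triangle (q + u) (Cconj v)). pose proof (Cmod_triangle q u).
  rewrite Cmod_conj in H. lra.
Qed.

(** The condition [c t <= 1] gives [|E| >= t], so the error [c t^2] is divided by at least [2 t^2]
    and remains bounded as [t] tends to [0]. *)
Lemma Cinv_near (E : C) (c t : R) : 0 < t -> c * t <= 1 ->
  Cmod (E - RtoC (2 * t)) <= c * t ^ 2 -> Cmod (/ E - RtoC (/ (2 * t))) <= c.
Proof.
  intros Ht Hc HE.
  assert (HEt : t <= Cmod E).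
  { pose proof (Cmod_triangle (E - RtoC (2 * t)) (- E)) as T.
    replace (E - RtoC (2 * t) + - E)%C with (- RtoC (2 * t))%C in T by ring.
    rewrite !Cmod_opp, Cmod_R, Rabs_pos_eq in T by lra. nra. }
  assert (HE0 : E <> RtoC 0) by (apply Cmod_gt_0; lra).
  assert (H2 : RtoC (2 * t) <> RtoC 0) by (intros X; injection X; lra).
  rewrite RtoC_inv by lra.
  replace (/ E - / RtoC (2 * t))%C with (- (E - RtoC (2 * t)) / (E * RtoC (2 * t)))%C
    by (field; auto).
  rewrite Cmod_div by now apply Cmult_neq_0.
  rewrite Cmod_opp, Cmod_mult, (Cmod_R (2 * t)), Rabs_pos_eq by lra.
  assert (Hden : 0 < Cmod E * (2 * t)) by (apply Rmult_lt_0_compat; lra).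
  apply Rmult_le_reg_r with (Cmod E * (2 * t)); auto.
  unfold Rdiv. rewrite Rmult_assoc, Rinv_l, Rmult_1_r by lra.
  eapply Rle_trans; [exact HE|].
  pose proof (Cmod_ge_0 (E - RtoC (2 * t))).
  assert (0 <= c) by (apply Rmult_le_reg_r with (t ^ 2); [apply pow_lt; lra|lra]).
  apply Rmult_le_compat_l; auto. nra.
Qed.

(** The coordinates of [g] multiply [H_g], and the inclusion makes them multipliers of [H_f], where
    a crossing of [f] identifies their boundary values. The theorem applies this in both
    directions. *)
Lemma crossing_transfer (d : nat) (V W : (nat -> C) -> Prop) (f g : C -> nat -> C) :
  embedding_map d V f -> embedding_map d W g ->
  (forall psi, in_Mf d g psi -> in_Mf d f psi) ->
  forall xi zeta : C, Cmod xi = 1 -> Cmod zeta = 1 -> f xi = f zeta -> g xi = g zeta.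
Proof.
  intros Hf Hg Hsub xi zeta Hxi Hzeta Hcross.
  destruct (boundary_approach d V f xi Hf Hxi) as (ga & Ma & ta & HMa & Hta & Ha).
  destruct (boundary_approach d V f zeta Hf Hzeta) as (gb & Mb & tb & HMb & Htb & Hb).
  destruct (embedding_extension d W g Hg) as (G & HG & HGholo).
  (* Taken with [p = 0] for the Lipschitz bound on the coordinates of [G] at [xi]. *)
  destruct (cinner_expansion d G (fun _ => RtoC 0) xi HGholo Hxi)
    as (La & Na & ea & HNa & Hea & Hga).
  destruct (cinner_expansion d G (fun _ => RtoC 0) zeta HGholo Hzeta)
    as (Lb & Nb & eb & HNb & Heb & Hgb).
  assert (f_ball : forall z, in_disc z -> vnorm d (f z) < 1)
    by (intros z; apply (embedding_ball d V); auto).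
  assert (g_ball : forall z, in_disc z -> vnorm d (g z) < 1)
    by (intros z; apply (embedding_ball d W); auto).
  assert (Hp : cinner d (f xi) (f xi) = RtoC 1).
  { rewrite cinner_self. destruct Hf as (_ & _ & _ & _ & _ & _ & Hn).
    rewrite (proj2 (Hn xi ltac:(lra)) Hxi). now rewrite pow1. }
  set (M := Rmax Ma Mb).
  assert (HM : Ma <= M /\ Mb <= M) by (split; [apply Rmax_l|apply Rmax_r]).
  set (c := 2 * M + INR d * M ^ 2).
  assert (Hc : 0 <= c).
  { unfold c. pose proof (pos_INR d). pose proof (pow2_ge_0 M). nra. }
  (* The bound [1 / (2 (c + 1))] gives both [c t <= 1], for [Cinv_near], and [1 / (2 tau) >= c + 1],
     so that [16^j / (2 tau) - c >= 16^j]. The last term keeps the points within the radii [ea],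
     [eb]. *)
  set (tau := Rmin (Rmin ta tb / 2) (Rmin (/ (2 * (c + 1))) (Rmin ea eb / (2 * (M + 1))))).
  assert (Htau : 0 < tau /\ tau < ta /\ tau < tb /\ tau <= / (2 * (c + 1)) /\
                 M * tau < ea /\ M * tau < eb).
  { assert (P1 : 0 < Rmin ta tb) by (apply Rmin_glb_lt; auto).
    assert (P2 : 0 < Rmin ea eb) by (apply Rmin_glb_lt; auto).
    assert (P3 : 0 < / (2 * (c + 1))) by (apply Rinv_0_lt_compat; lra).
    assert (P4 : 0 < Rmin ea eb / (2 * (M + 1))) by (apply Rdiv_lt_0_compat; lra).
    pose proof (Rmin_l ta tb). pose proof (Rmin_r ta tb).
    pose proof (Rmin_l ea eb). pose proof (Rmin_r ea eb).
    pose proof (Rmin_l (Rmin ta tb / 2) (Rmin (/ (2 * (c + 1))) (Rmin ea eb / (2 * (M + 1))))) as Q1.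
    pose proof (Rmin_r (Rmin ta tb / 2) (Rmin (/ (2 * (c + 1))) (Rmin ea eb / (2 * (M + 1))))) as Q2.
    pose proof (Rmin_l (/ (2 * (c + 1))) (Rmin ea eb / (2 * (M + 1)))) as Q3.
    pose proof (Rmin_r (/ (2 * (c + 1))) (Rmin ea eb / (2 * (M + 1)))) as Q4.
    fold tau in Q1, Q2.
    assert (P5 : 0 < tau) by (repeat apply Rmin_glb_lt; lra).
    assert (P6 : (M + 1) * tau <= Rmin ea eb / 2).
    { apply Rle_trans with ((M + 1) * (Rmin ea eb / (2 * (M + 1)))).
      - apply Rmult_le_compat_l; lra.
      - right. field. lra. }
    repeat split; lra || nra. }
  destruct Htau as (Ht0 & Ht1 & Ht2 & Ht3 & Ht4 & Ht5).
  set (t := fun j : nat => tau * (/16) ^ j).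
  assert (H16 : forall j, 0 < (/16) ^ j <= 1).
  { intros j. split; [apply pow_lt; lra|]. rewrite <- (pow1 j). apply pow_incr. lra. }
  assert (Ht : forall j, 0 < t j <= tau).
  { intros j. specialize (H16 j). unfold t. split; nra. }
  set (zs := fun j => ga (t j)). set (ws := fun j => gb (t j)).
  assert (Hz : forall j, in_disc (zs j)) by (intros j; apply Ha; specialize (Ht j); lra).
  assert (Hw : forall j, in_disc (ws j)) by (intros j; apply Hb; specialize (Ht j); lra).
  assert (Hker : forall j x y, (x = zs j \/ x = ws j) -> (y = zs j \/ y = ws j) ->
    Cmod (kf d f x y - RtoC (/ (2 * t j))) <= c).
  { intros j. specialize (Ht j).
    assert (Hx : forall x, x = zs j \/ x = ws j ->
      Cmod (cinner d (f x) (f xi) - (1 - RtoC (t j))) <= M * t j ^ 2 /\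
      forall i, (i < d)%nat -> Cmod (f x i - f xi i) <= M * t j).
    { assert (0 <= t j ^ 2) by apply pow2_ge_0.
      intros x [->| ->].
      - destruct (Ha (t j) ltac:(lra)) as (_ & _ & A1 & A2). split; [unfold zs; nra|].
        intros i Hi. specialize (A2 i Hi). unfold zs. nra.
      (* The crossing enters here: the branch at [zeta] is measured against the same point
         [p = f xi]. *)
      - rewrite Hcross.
        destruct (Hb (t j) ltac:(lra)) as (_ & _ & A1 & A2). split; [unfold ws; nra|].
        intros i Hi. specialize (A2 i Hi). unfold ws. nra. }
    intros x y Hxj Hyj. destruct (Hx x Hxj) as [X1 X2]. destruct (Hx y Hyj) as [Y1 Y2].
    apply Cinv_near; [lra| |apply (cinner_near d _ _ (f xi)); auto; lra].
    apply Rle_trans with (c * / (2 * (c + 1))).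
    - apply Rmult_le_compat_l; lra.
    - apply Rmult_le_reg_r with (2 * (c + 1)); [lra|].
      rewrite Rmult_assoc, Rinv_l by lra. lra. }
  assert (HkRe : forall j x y, (x = zs j \/ x = ws j) -> (y = zs j \/ y = ws j) ->
    Rabs (Re (kf d f x y) - / (2 * t j)) <= c).
  { intros j x y Hx Hy. eapply Rle_trans; [|apply (Hker j x y Hx Hy)].
    eapply Rle_trans; [|apply re_le_Cmod]. right. f_equal. }
  assert (Hcoord : forall i, (i < d)%nat -> g xi i = g zeta i).
  { intros i Hi.
    (* In the alternating sum of four kernel values the terms [1 / (2 t)] cancel, leaving four
       errors of at most [c] each. *)
    destruct (multiplier_asymptotic_collapse in_disc (kf d f) zs ws (fun z => g z i) (4 * c))
      as [B HB]; auto.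
    - now apply kf_psd.
    - now apply kf_hermitian.
    - intros; now apply kf_Re_pos.
    - intros j.
      pose proof (HkRe j (zs j) (zs j) (or_introl eq_refl) (or_introl eq_refl)) as K1.
      apply Rabs_le_between in K1.
      assert (E : / (2 * t j) = 16 ^ j * / (2 * tau)).
      { unfold t. rewrite pow_inv. field. split; try lra; apply pow_nonzero; lra. }
      assert (P16 : 1 <= 16 ^ j) by (apply pow_R1_Rle; lra).
      assert (Hbig : c + 1 <= / (2 * tau)).
      { apply Rmult_le_reg_r with (2 * tau); [lra|]. rewrite Rinv_l by lra.
        apply Rle_trans with ((c + 1) * (2 * / (2 * (c + 1)))).
        - apply Rmult_le_compat_l; lra.
        - right. field. lra. }
      rewrite E in K1. nra.
    - intros j.
      pose proof (HkRe j (zs j) (zs j) (or_introl eq_refl) (or_introl eq_refl)) as K1.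
      pose proof (HkRe j (zs j) (ws j) (or_introl eq_refl) (or_intror eq_refl)) as K2.
      pose proof (HkRe j (ws j) (zs j) (or_intror eq_refl) (or_introl eq_refl)) as K3.
      pose proof (HkRe j (ws j) (ws j) (or_intror eq_refl) (or_intror eq_refl)) as K4.
      apply Rabs_le_between in K1, K2, K3, K4. unfold Cminus.
      rewrite !re_plus, !re_opp. lra.
    - apply Hsub. now apply coord_in_Mf.
    - intros j. eapply Rle_trans; [apply (coord_le_vnorm d); auto|].
      left. now apply g_ball.
    (* A fixed number is bounded by a multiple of [2^-j] for every [j], hence zero. The Lipschitz
       errors decay like [16^-j] and are absorbed into the slower rate. *)
    - assert (HL : forall j, Cmod (g xi i - g zeta i) <= (B + (Na + Nb) * (M * tau)) * (/2) ^ j).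
      { intros j. specialize (HB j). cbv beta in HB. specialize (Ht j).
        destruct (Ha (t j) ltac:(lra)) as (_ & A1 & _).
        destruct (Hb (t j) ltac:(lra)) as (_ & A2 & _).
        fold (zs j) in A1. fold (ws j) in A2.
        assert (A1' : Cmod (zs j - xi) <= M * t j) by nra.
        assert (A2' : Cmod (ws j - zeta) <= M * t j) by nra.
        assert (Hmt : M * t j <= M * tau) by (apply Rmult_le_compat_l; lra).
        destruct (Hga (zs j) ltac:(lra)) as [_ G1]. specialize (G1 i Hi).
        destruct (Hgb (ws j) ltac:(lra)) as [_ G2]. specialize (G2 i Hi).
        rewrite !HG in G1 by (lra || (specialize (Hz j); unfold in_disc in Hz; lra)).
        rewrite !HG in G2 by (lra || (specialize (Hw j); unfold in_disc in Hw; lra)).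
        replace (g xi i - g zeta i)%C with
          (- (g (zs j) i - g xi i) + ((g (zs j) i - g (ws j) i) + (g (ws j) i - g zeta i)))%C
          by ring.
        eapply Rle_trans; [apply Cmod_triangle|]. rewrite Cmod_opp.
        pose proof (Cmod_triangle (g (zs j) i - g (ws j) i) (g (ws j) i - g zeta i)) as T.
        assert (H2 : (/16) ^ j <= (/2) ^ j) by (apply pow_incr; lra).
        assert (T1 : t j <= tau * (/2) ^ j) by (unfold t; apply Rmult_le_compat_l; lra).
        assert (T2 : M * t j <= M * (tau * (/2) ^ j)) by (apply Rmult_le_compat_l; lra).
        assert (G1' : Na * Cmod (zs j - xi) <= Na * (M * (tau * (/2) ^ j)))
          by (apply Rmult_le_compat_l; lra).
        assert (G2' : Nb * Cmod (ws j - zeta) <= Nb * (M * (tau * (/2) ^ j)))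
          by (apply Rmult_le_compat_l; lra).
        lra. }
      apply Ceq_minus, Cmod_eq_0, Rle_antisym; [|apply Cmod_ge_0].
      set (B' := B + (Na + Nb) * (M * tau)) in HL.
      apply (is_lim_seq_le (fun _ => Cmod (g xi i - g zeta i)) (fun j => B' * (/2) ^ j)
        (Cmod (g xi i - g zeta i)) 0 HL).
      + apply is_lim_seq_const.
      + replace (Finite 0) with (Finite (B' * 0)) by (f_equal; ring).
        apply is_lim_seq_mult'; [apply is_lim_seq_const|].
        apply is_lim_seq_geom. rewrite Rabs_pos_eq; lra. }
  apply functional_extensionality. intros i.
  destruct (Nat.lt_ge_cases i d) as [Hi|Hi]; [auto|].
  destruct Hg as (_ & Hvec & _).
  rewrite (Hvec xi ltac:(lra) i Hi), (Hvec zeta ltac:(lra) i Hi). reflexivity.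
Qed.

Theorem theorem1p1 (d : nat) (V W : (nat -> C) -> Prop) (f g : C -> nat -> C) :
  embedding_map d V f ->
  embedding_map d W g ->
  (forall psi : C -> C, in_Mf d f psi <-> in_Mf d g psi) ->
  forall xi zeta : C, Cmod xi = 1 -> Cmod zeta = 1 ->
    (f xi = f zeta <-> g xi = g zeta).
Proof.
  intros Hf Hg H xi zeta Hxi Hzeta. split.
  - apply (crossing_transfer d V W f g); auto. intros psi. apply H.
  - apply (crossing_transfer d W V g f); auto. intros psi. apply H.
Qed.
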